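(* There exist infinitely many pairwise non-isomorphic smooth intersections of two quadrics over $\mathbb{Q}$ which have index $2$ but have no closed points of degree $2$.
   Context: The index of a variety over a field is the greatest common divisor of the degrees of its closed points. A smooth intersection of two quadrics over $\mathbb{Q}$ is a smooth complete intersection $V(Q_1,Q_2)\subset \mathbb{P}^n_{\mathbb{Q}}$ of two quadric hypersurfaces. *)

(* Defs.v *)
From HB Require Import structures.
From mathcomp Require Import all_boot all_order all_algebra all_field.
From mathcomp Require Import mpoly.

Set Implicit Arguments.
Unset Strict Implicit.
Unset Printing Implicit Defensive.

Import GRing.Theory.
Local Open Scope ring_scope.

(* A pair of forms on P^n over Q, standing for the closed subscheme
   V(Q1, Q2) of P^n; the coordinates are indexed by 'I_n.+1.  The ambient
   dimension n is part of the data and is not fixed. *)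
Record quadric_pair := QuadricPair {
  ambdim : nat;
  form1 : {mpoly rat[ambdim.+1]};
  form2 : {mpoly rat[ambdim.+1]}
}.

(* x annihilates both forms, whose coefficients are moved to L along iota;
   x = 0 is not excluded here. *)
Definition on_forms (L : comNzRingType) (iota : rat -> L) (X : quadric_pair)
    (x : 'I_(ambdim X).+1 -> L) : Prop :=
  mmap iota x (form1 X) = 0 /\ mmap iota x (form2 X) = 0.

(* Homogeneous coordinates of the points of X over algC, the algebraic closure
   of Q. *)
Definition geom_point (X : quadric_pair) (x : 'rV[algC]_(ambdim X).+1) : Prop :=
  x != 0 /\ on_forms ratr (x 0).

Definition proj_eq (n : nat) (x y : 'rV[algC]_n.+1) : Prop :=
  exists2 c : algC, c != 0 & y = c *: x.

(* Codimension 2: the two forms are a regular sequence in Q[x_0, ..., x_n]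
   (for two forms, equivalently, the hypersurfaces have no common component). *)
Definition complete_intersection (X : quadric_pair) : Prop :=
  form1 X != 0 /\
  forall f g : {mpoly rat[(ambdim X).+1]},
    f * form2 X = g * form1 X -> exists h, f = h * form1 X.

Definition jacobian_at (X : quadric_pair) (x : 'rV[algC]_(ambdim X).+1) :
    'M[algC]_(2, (ambdim X).+1) :=
  \matrix_(i < 2, j < (ambdim X).+1)
    mmap ratr (x 0) (mderiv j (if i == ord0 then form1 X else form2 X)).

Definition smooth (X : quadric_pair) : Prop :=
  forall x, geom_point (X := X) x -> \rank (jacobian_at x) = 2%N.

Definition smooth_intersection_of_two_quadrics (X : quadric_pair) : Prop :=
  [/\ form1 X \is 2.-homog, form2 X \is 2.-homog,
      complete_intersection X & smooth X].

(* A closed point of X lying in the affine chart x_j = 1 is a maximal ideal of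
   Q[x_0, ..., x_n] / (Q1, Q2, x_j - 1), i.e. the kernel of a Q-algebra morphism
   from this ring onto its residue field, which is a finite extension of Q.
   Such a surjection is determined by the images of the coordinates, which
   generate the residue field over Q.  One closed point has several
   presentations of this form (other charts, isomorphic residue fields), all of
   the same degree. *)
Record closed_point (X : quadric_pair) := ClosedPoint {
  residue_field : fieldExtType rat;
  cp_coord : 'I_(ambdim X).+1 -> residue_field;
  _ : exists j, cp_coord j = 1;
  _ : on_forms (in_alg residue_field) cp_coord;
  _ : <<1 & [seq cp_coord i | i : 'I_(ambdim X).+1]>>%VS
        = {: residue_field}%VS
}.

Definition cp_degree (X : quadric_pair) (P : closed_point X) : nat :=
  \dim {: residue_field P}.

(* d is the gcd of the set of all degrees of closed points. *)
Definition has_index (X : quadric_pair) (d : nat) : Prop :=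
  (forall P : closed_point X, (d %| cp_degree P)%N) /\
  forall e : nat, (forall P : closed_point X, (e %| cp_degree P)%N) ->
    (e %| d)%N.

(* Morphisms of varieties over Q, given by their action on geometric points (the
   varieties in play are smooth, hence geometrically reduced): Zariski-locally f
   is given by forms of a common degree with rational coefficients.  f acts on
   homogeneous coordinates, and its compatibility with scaling follows from
   the last clause. *)
Definition is_morphism (X Y : quadric_pair)
    (f : 'rV[algC]_(ambdim X).+1 -> 'rV[algC]_(ambdim Y).+1) : Prop :=
  forall x, geom_point (X := X) x ->
    geom_point (X := Y) (f x) /\
    exists (d : nat) (F : 'I_(ambdim Y).+1 -> {mpoly rat[(ambdim X).+1]}),
      let Fval (z : 'rV[algC]_(ambdim X).+1) :=
        \row_(i < (ambdim Y).+1) mmap ratr (z 0) (F i) in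
      [/\ forall i, F i \is d.-homog,
          Fval x != 0
        & forall z, geom_point (X := X) z -> Fval z != 0 ->
            proj_eq (Fval z) (f z)].

Definition isomorphic (X Y : quadric_pair) : Prop :=
  exists (f : 'rV[algC]_(ambdim X).+1 -> 'rV[algC]_(ambdim Y).+1)
         (g : 'rV[algC]_(ambdim Y).+1 -> 'rV[algC]_(ambdim X).+1),
    [/\ is_morphism (X := X) (Y := Y) f,
        is_morphism (X := Y) (Y := X) g,
        forall x, geom_point (X := X) x -> proj_eq x (g (f x))
      & forall y, geom_point (X := Y) y -> proj_eq y (f (g y))].

(* Main.v *)
Require Import Defs.
From Stdlib Require Import ClassicalEpsilon.
From HB Require Import structures.
From mathcomp Require Import all_boot all_order all_algebra all_field.
From mathcomp Require Import polyrcf realalg.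
From mathcomp Require Import mpoly.
From mathcomp Require Import zify ring lra.

(** The surfaces are X_N : Q1 = Q2 = 0 in P^4 with
      Q1 = x^2 + y^2 + 3N (z^2 + 2v^2),
      Q2 = 2w^2 - x^2 - 2xy - 6N (z^2 + 2zv + 2v^2),
    for N a product of primes congruent to 1 modulo 3.

    Index: X_N has no real point, so all degrees are even.  It has a point over
    Q(sqrt(-3N), sqrt(6N)).  Over the cubic field Q(k), k^3 + k + 1 = 0, the member
    (1 + k) Q1 + Q2 for N = 1 contains an explicit plane (projectively, a line); if N is a norm
    U^2 + 2 g V^2 from Q(k), g = k^2 - 2k - 1, the plane can be moved to X_N, and intersecting it
    with Q1 gives a point of degree dividing 6.

    No point of degree 2: such a point spans a rational totally isotropic plane of some member
    s Q1 + u Q2, s and u coprime integers.  Let F = s^2 - su - u^2.  The signature over the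
    reals forces F < 0, at primes q = 2 mod 3 the discriminant forces an even valuation of F, so that
    -F = 1 mod 3; and then the member has no such plane over Q_3.

    Family: N runs through squarefree parts of a polynomial b |-> nu0^2 + 2 nu1^2 whose values are
    at the same time norms U^2 + 2 g V^2 and A^2 - A B + B^2; for b = 1 mod 8 they have a
    prime factor q = 3 mod 4, and X_N has no Q_q-point.  If M is built from a value b divisible by q,
    then -2, -3 and M are squares modulo q, so the field Q(sqrt(-2), sqrt(-3M)), over which X_M has
    a point, embeds in Q_q: there is no morphism from X_M to X_N. *)

Set Implicit Arguments.
Unset Strict Implicit.
Unset Printing Implicit Defensive.

Import Order.TTheory GRing.Theory Num.Theory.
Local Open Scope ring_scope.

(** The three local conditions are the product formula for the Hilbert symbol (-3, F) in elementary
    form: it is -1 at infinity because F < 0, and 1 at every prime other than 3, so it is -1 at 3.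
    Since s^2 - su - u^2 has no nontrivial zero modulo 3, F is a 3-adic unit for coprime s and u,
    and this says F = -1 mod 3, exactly the case without planes over Q_3. The cubic member escapes
    because that form splits over F_9: modulo 3 the cubic is (k - 1)(k^2 + k - 1), and F(1 + k, 1) =
    k^2 + k - 1, of norm 9 up to sign, lies in the prime of residue degree 2 above 3. Rescaling z
    and v by sqrt N makes all X_N isomorphic over [algC], so no geometric invariant separates them;
    the surfaces are told apart by the fields over which they have points. This is why N must at
    once leave the obstruction intact (primes 1 mod 3), keep the plane over Q(k) (norm condition)
    and destroy the points over some Q_q. *)

(** * Integral planes and their reduction modulo a prime *)

Definition minor (R : comPzRingType) (a b : nat -> R) i j : R :=
  a i * b j - a j * b i.

Lemma dvdz_logn (p m : nat) (z : int) : prime p -> z != 0 ->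
  ((p ^ m)%N %| z)%Z = (m <= logn p `|z|)%N.
Proof. by move=> pp z0; rewrite dvdzE absz_nat pfactor_dvdn // absz_gt0. Qed.

(** Take a minor (i, j) of least p-adic valuation m. The vectors of minors (k, j) and (i, k),
    indexed by k, lie in the rational plane of [a] and [b] and stay integral after division by p^m;
    their own (i, j) minor is then the square of a number prime to p. *)
Lemma saturated_plane (p n : nat) (a b : nat -> int) : prime p ->
  (exists i j, [/\ (i < n)%N, (j < n)%N & minor a b i j != 0]) ->
  exists a' b' : nat -> int,
    (exists al be ga de d : int, d != 0 /\ forall k, (k < n)%N ->
       d * a' k = al * a k + be * b k /\ d * b' k = ga * a k + de * b k) /\
    exists i j, [/\ (i < n)%N, (j < n)%N & ~~ (p %| minor a' b' i j)%Z].
Proof.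
move=> pp [i0 [j0 [li0 lj0 nz0]]].
pose Q m := [exists i : 'I_n, [exists j : 'I_n,
  (minor a b i j != 0) && (logn p `|minor a b i j| == m)]].
have exQ : exists m, Q m.
  exists (logn p `|minor a b i0 j0|).
  apply/existsP; exists (Ordinal li0); apply/existsP; exists (Ordinal lj0).
  by rewrite nz0 eqxx.
have [m /existsP[i /existsP[j /andP[nz /eqP vm]]] minm] := ex_minnP exQ.
have dv k l : (k < n)%N -> (l < n)%N -> ((p ^ m)%N %| minor a b k l)%Z.
  move=> lk ll; have [-> | nzk] := eqVneq (minor a b k l) 0; first by rewrite dvdz0.
  rewrite dvdz_logn //; apply: minm.
  apply/existsP; exists (Ordinal lk); apply/existsP; exists (Ordinal ll).
  by rewrite nzk eqxx.
have pm0 : ((p ^ m)%N : int) != 0 by rewrite -lt0n expn_gt0 prime_gt0.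
pose q k l := (minor a b k l %/ (p ^ m)%N)%Z.
have qE k l : (k < n)%N -> (l < n)%N -> (p ^ m)%N%:Z * q k l = minor a b k l.
  by move=> lk ll; rewrite mulrC divzK // dv.
exists (fun k => q k j), (fun k => q i k); split.
  exists (b j), (- a j), (- b i), (a i), (p ^ m)%N; split=> // k lk.
  by rewrite !qE // /minor; split; ring.
exists (i : nat), (j : nat); split=> //.
have qjj : q j j = 0 by rewrite /q /minor subrr div0z.
rewrite {1}/minor /= qjj mul0r subr0.
have nq : ~~ (p %| q i j)%Z.
  apply/negP => pq; suff : (m < logn p `|minor a b i j|)%N by rewrite vm ltnn.
  rewrite -dvdz_logn //.
  have -> : ((p ^ m.+1)%N : int) = (p ^ m)%N%:Z * p by rewrite expnSr PoszM.
  by rewrite -(qE _ _ (ltn_ord i) (ltn_ord j)) dvdz_mul2l.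
apply: contra nq; rewrite !dvdzE !absz_nat abszM Euclid_dvdM //.
by case/orP.
Qed.

Lemma dvdz_primeM (p : nat) (x y : int) : prime p ->
  (p %| x * y)%Z = (p %| x)%Z || (p %| y)%Z.
Proof. by move=> pp; rewrite !dvdzE absz_nat abszM Euclid_dvdM. Qed.

Lemma dvdz_prime_pow (p : nat) (x : int) k : prime p ->
  (p %| x ^+ k.+1)%Z = (p %| x)%Z.
Proof.
move=> pp; elim: k => [|k IHk]; first by rewrite expr1.
by rewrite exprS dvdz_primeM // IHk orbb.
Qed.

Lemma Fp_intr_eq0 (p : nat) (x : int) : prime p ->
  (x%:~R == 0 :> 'F_p) = (p %| x)%Z.
Proof. by move=> pp; rewrite (dvdz_pcharf (pchar_Fp pp)). Qed.

(** If some a_k is prime to p, the entries of b_k a - a_k b are themselves minors; otherwise [a]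
    vanishes modulo p. The list [I] holds the coordinates that the reduced form sees. *)
Lemma dependent_mod (p : nat) (I : seq nat) (a b : nat -> int) : prime p ->
  (forall i j, i \in I -> j \in I -> (p %| minor a b i j)%Z) ->
  exists c d : int, ~~ ((p %| c)%Z && (p %| d)%Z) /\
    forall i, i \in I -> (p %| c * a i + d * b i)%Z.
Proof.
move=> pp mab; have [/allP a0 | /allPn[k kI ak]] := boolP (all (fun i => (p %| a i)%Z) I).
  exists 1, 0; split=> [|i iI]; last by rewrite mul1r mul0r addr0 a0.
  by rewrite dvdz1 absz_nat; case: (p) pp => [|[|?]].
exists (b k), (- a k); split=> [|i iI].
  by rewrite rpredN (negbTE ak) andbF.
have -> : b k * a i + - a k * b i = minor a b i k by rewrite /minor; ring.
exact: mab.
Qed.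

Lemma combination_neq0_mod (p : nat) (a b : nat -> int) (c d : int) i j : prime p ->
  ~~ (p %| minor a b i j)%Z -> ~~ ((p %| c)%Z && (p %| d)%Z) ->
  ~~ ((p %| c * a i + d * b i)%Z && (p %| c * a j + d * b j)%Z).
Proof.
move=> pp nm; apply: contra => /andP[hi hj].
have hc : (p %| c * minor a b i j)%Z.
  have -> : c * minor a b i j =
      (c * a i + d * b i) * b j - (c * a j + d * b j) * b i.
    by rewrite /minor; ring.
  by rewrite rpredB // dvdz_mulr.
have hd : (p %| d * minor a b i j)%Z.
  have -> : d * minor a b i j =
      (c * a j + d * b j) * a i - (c * a i + d * b i) * a j.
    by rewrite /minor; ring.
  by rewrite rpredB // dvdz_mulr.
by move: hc hd; rewrite !dvdz_primeM // (negbTE nm) !orbF => -> ->.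
Qed.

(** * The pencil, and two forms without isotropic planes *)

(** Polar form of the member s Q1 + u Q2; the indices 0, 1, 2, 3, 4 stand for x, y, z, v, w. *)
Definition pencil (R : comPzRingType) (N s u : R) (a b : nat -> R) : R :=
  s * (a 0%N * b 0%N + a 1%N * b 1%N
       + 3%:R * N * (a 2 * b 2 + 2%:R * (a 3 * b 3)))
  + u * (2%:R * (a 4 * b 4) - a 0%N * b 0%N - (a 0%N * b 1%N + a 1%N * b 0%N)
         - 6%:R * N * (a 2 * b 2 + a 2 * b 3 + a 3 * b 2 + 2%:R * (a 3 * b 3))).

Definition isotropic (R : comPzRingType) (f : (nat -> R) -> (nat -> R) -> R)
    (a b : nat -> R) : Prop := [/\ f a a = 0, f a b = 0 & f b b = 0].

(** A nondegenerate ternary form has Witt index at most 1, and [T] has determinant 2u(s^2 - su -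
    u^2). It is the (x, y, w)-block of a member, all that remains of the member modulo 3. *)
Lemma ternary_isotropic (F : fieldType) (s u : F) (a b : nat -> F)
    (T := fun a b => s * (a 0%N * b 0%N + a 1%N * b 1%N)
      + u * (2%:R * (a 2 * b 2) - a 0%N * b 0%N - (a 0%N * b 1%N + a 1%N * b 0%N))) :
  2%:R != 0 :> F -> u != 0 -> s ^+ 2 - s * u - u ^+ 2 != 0 ->
  isotropic T a b -> forall i j, (i < 3)%N -> (j < 3)%N -> minor a b i j = 0.
Proof.
move=> n2 u0 F0 [Taa Tab Tbb].
set x := a 0%N in Taa Tab *; set y := a 1%N in Taa Tab *; set w := a 2 in Taa Tab *.
pose x' := b 0%N; pose y' := b 1%N; pose w' := b 2.
(* The values of [T] on the plane become relations between its minors. If the (0, 1) minor is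
   nonzero, [e1] and [e2] put the minors (2, 0), (2, 1) in the kernel of the (x, y)-block, whose
   determinant is s^2 - su - u^2. *)
have e1 : (minor a b 0 1) * (s * minor a b 2 1 - u * minor a b 2 0) = 0.
  transitivity (x * w * T b b + x' * w' * T a a - (x * w' + w * x') * T a b).
    by rewrite /minor /T -/x -/y -/w -/x' -/y' -/w'; ring.
  by rewrite Taa Tab Tbb; ring.
have e2 : (minor a b 0 1) * ((s - u) * minor a b 2 0 - u * minor a b 2 1) = 0.
  transitivity ((y * w' + w * y') * T a b - y * w * T b b - y' * w' * T a a).
    by rewrite /minor /T -/x -/y -/w -/x' -/y' -/w'; ring.
  by rewrite Taa Tab Tbb; ring.
have e3 : 2%:R * u * minor a b 0 2 ^+ 2 + s * minor a b 0 1 ^+ 2 = 0.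
  transitivity (x ^+ 2 * T b b + x' ^+ 2 * T a a - 2%:R * x * x' * T a b).
    by rewrite /minor /T -/x -/y -/w -/x' -/y' -/w'; ring.
  by rewrite Taa Tab Tbb; ring.
have e4 : 2%:R * u * minor a b 1 2 ^+ 2 + (s - u) * minor a b 0 1 ^+ 2 = 0.
  transitivity (y ^+ 2 * T b b + y' ^+ 2 * T a a - 2%:R * y * y' * T a b).
    by rewrite /minor /T -/x -/y -/w -/x' -/y' -/w'; ring.
  by rewrite Taa Tab Tbb; ring.
have m01 : minor a b 0 1 = 0.
  apply/eqP; apply: contraT => n01.
  move/eqP: e1; rewrite mulf_eq0 (negbTE n01) /= => /eqP e1.
  move/eqP: e2; rewrite mulf_eq0 (negbTE n01) /= => /eqP e2.
  have f20 : (s ^+ 2 - s * u - u ^+ 2) * minor a b 2 0 = 0.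
    transitivity (s * ((s - u) * minor a b 2 0 - u * minor a b 2 1)
      + u * (s * minor a b 2 1 - u * minor a b 2 0)); first by ring.
    by rewrite e1 e2; ring.
  have f21 : (s ^+ 2 - s * u - u ^+ 2) * minor a b 2 1 = 0.
    transitivity (u * ((s - u) * minor a b 2 0 - u * minor a b 2 1)
      + (s - u) * (s * minor a b 2 1 - u * minor a b 2 0)); first by ring.
    by rewrite e1 e2; ring.
  move/eqP: f20; rewrite mulf_eq0 (negbTE F0) /= => /eqP f20.
  move/eqP: f21; rewrite mulf_eq0 (negbTE F0) /= => /eqP f21.
  have g02 : minor a b 0 2 = 0 by rewrite -[LHS]opprK -oppr0 -f20 /minor; ring.
  have g12 : minor a b 1 2 = 0 by rewrite -[LHS]opprK -oppr0 -f21 /minor; ring.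
  move: e3 e4; rewrite g02 g12 expr0n /= mulr0 !add0r => /eqP.
  rewrite mulf_eq0 expf_eq0 /= (negbTE n01) orbF => /eqP s0 /eqP.
  by rewrite mulf_eq0 expf_eq0 /= (negbTE n01) orbF s0 sub0r oppr_eq0 (negbTE u0).
have m02 : minor a b 0 2 = 0.
  move/eqP: e3; rewrite m01 expr0n /= mulr0 addr0 !mulf_eq0 (negbTE n2) (negbTE u0) /=.
  by rewrite orbb => /eqP.
have m12 : minor a b 1 2 = 0.
  move/eqP: e4; rewrite m01 expr0n /= mulr0 addr0 !mulf_eq0 (negbTE n2) (negbTE u0) /=.
  by rewrite orbb => /eqP.
have mN i j : minor a b i j = - minor a b j i by rewrite /minor; ring.
have mD i : minor a b i i = 0 by rewrite /minor; ring.
case=> [|[|[|//]]] [|[|[|//]]] _ _ //; rewrite mN ?m01 ?m02 ?m12 ?mD oppr0 //.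
Qed.

(** This is s times a member after completing the square in y: the coordinates are w, sy - ux, z, v,
    and the remaining term (s^2 - su - u^2) x^2 is left out. *)
Definition quaternary (R : comPzRingType) (N s u : R) (a b : nat -> R) : R :=
  2%:R * u * s * (a 0%N * b 0%N) + a 1%N * b 1%N
  + 3%:R * N * s * ((s - 2%:R * u) * (a 2 * b 2 + 2%:R * (a 3 * b 3))
                    - 2%:R * u * (a 2 * b 3 + a 3 * b 2)).

(* On s^2 = su + u^2 the quaternary form has discriminant -3 up to squares. *)
Lemma quaternary_isotropic (F : fieldType) (N s u : F) (a b : nat -> F) :
  6%:R != 0 :> F -> N != 0 -> s != 0 -> u != 0 -> s ^+ 2 - s * u - u ^+ 2 = 0 ->
  (forall t : F, t ^+ 2 != - 3%:R) -> isotropic (quaternary N s u) a b ->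
  forall i j, (i < 4)%N -> (j < 4)%N -> minor a b i j = 0.
Proof.
move=> n6 N0 s0 u0 F0 nsq [Raa Rab Rbb].
have [n2 n3] : 2%:R != 0 :> F /\ 3%:R != 0 :> F.
  have: 2%:R * 3%:R != 0 :> F by rewrite -natrM.
  by rewrite mulf_eq0 negb_or => /andP.
have nsq2 (t d : F) : d != 0 -> t ^+ 2 = - 3%:R * d ^+ 2 -> False.
  move=> d0 e; have /negP[] := nsq (t / d).
  by rewrite expr_div_n e mulfK // expf_neq0.
have us : s * (s - u) = u ^+ 2.
  by apply/eqP; rewrite -subr_eq0 -[X in _ == X]F0; apply/eqP; ring.
pose H (a b : nat -> F) : F := 3%:R * N * s * ((s - 2%:R * u) * (a 2 * b 2 + 2%:R * (a 3 * b 3))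
                    - 2%:R * u * (a 2 * b 3 + a 3 * b 2)).
(* On an isotropic plane the halves in coordinates 0, 1 and in coordinates 2, 3 are opposite, so
   their Gram determinants agree; with s^2 = su + u^2 this makes one square equal to -3 times
   another. *)
have e1 : minor a b 0 1 ^+ 2 = - 3%:R * (3%:R * N * u * minor a b 2 3) ^+ 2.
  apply/eqP; rewrite -subr_eq0.
  suff : 2%:R * u * s * (minor a b 0 1 ^+ 2 - - 3%:R * (3%:R * N * u * minor a b 2 3) ^+ 2) = 0.
    by move/eqP; rewrite !mulf_eq0 (negbTE n2) (negbTE u0) (negbTE s0).
  transitivity (quaternary N s u a a * quaternary N s u b b
    - quaternary N s u a b ^+ 2
    - quaternary N s u a a * H b b - quaternary N s u b b * H a a
    + 2%:R * quaternary N s u a b * H a b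
    + (s ^+ 2 - s * u - u ^+ 2) * (18%:R * N ^+ 2 * s ^+ 2 - 54%:R * N ^+ 2 * u * s)
      * minor a b 2 3 ^+ 2).
    by rewrite /quaternary /H /minor; ring.
  by rewrite Raa Rab Rbb F0; ring.
have m23 : minor a b 2 3 = 0.
  apply/eqP; apply: contraT => n; exfalso; apply: nsq2 e1.
  by rewrite !mulf_neq0.
have m01 : minor a b 0 1 = 0.
  by apply/eqP; rewrite -sqrf_eq0 e1 m23 mulr0 expr0n /= mulr0.
have eW : (s - 2%:R * u) * (minor a b 0 2 ^+ 2 + 2%:R * minor a b 0 3 ^+ 2)
          - 4%:R * u * minor a b 0 2 * minor a b 0 3 = 0.
  apply/eqP; suff : 3%:R * N * s * ((s - 2%:R * u) * (minor a b 0 2 ^+ 2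
      + 2%:R * minor a b 0 3 ^+ 2) - 4%:R * u * minor a b 0 2 * minor a b 0 3) = 0.
    by move/eqP; rewrite !mulf_eq0 (negbTE n3) (negbTE N0) (negbTE s0).
  transitivity (a 0%N ^+ 2 * quaternary N s u b b + b 0%N ^+ 2 * quaternary N s u a a
    - 2%:R * a 0%N * b 0%N * quaternary N s u a b - minor a b 0 1 ^+ 2).
    by rewrite /quaternary /minor; ring.
  by rewrite Raa Rab Rbb m01; ring.
have eZ : minor a b 1 2 ^+ 2 = - (2%:R * u * s) * minor a b 0 2 ^+ 2.
  apply/eqP; rewrite -subr_eq0; apply/eqP.
  transitivity (a 2 ^+ 2 * quaternary N s u b b + b 2 ^+ 2 * quaternary N s u a a
    - 2%:R * a 2 * b 2 * quaternary N s u a b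
    - 6%:R * N * s * (s - 2%:R * u) * minor a b 2 3 ^+ 2).
    by rewrite /quaternary /minor; ring.
  by rewrite Raa Rab Rbb m23; ring.
have eV : minor a b 1 3 ^+ 2 = - (2%:R * u * s) * minor a b 0 3 ^+ 2.
  apply/eqP; rewrite -subr_eq0; apply/eqP.
  transitivity (a 3 ^+ 2 * quaternary N s u b b + b 3 ^+ 2 * quaternary N s u a a
    - 2%:R * a 3 * b 3 * quaternary N s u a b
    - 3%:R * N * s * (s - 2%:R * u) * minor a b 2 3 ^+ 2).
    by rewrite /quaternary /minor; ring.
  by rewrite Raa Rab Rbb m23; ring.
(* Both -2us and 6u(s - u) would be squares; their product is -12 u^2 s(s - u) = -3 (2u^2)^2. *)
have cross (x p q : F) : x != 0 -> p ^+ 2 = - (2%:R * u * s) * x ^+ 2 ->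
    q ^+ 2 = 6%:R * u * (s - u) * x ^+ 2 -> False.
  move=> x0 ep eq; apply: (@nsq2 (p * q) (2%:R * u ^+ 2 * x ^+ 2)).
    by rewrite !mulf_neq0 ?expf_neq0.
  rewrite exprMn ep eq.
  transitivity (- 3%:R * (2%:R * u * x ^+ 2) ^+ 2 * (s * (s - u))); first by ring.
  by rewrite us; ring.
have m02 : minor a b 0 2 = 0.
  apply/eqP; apply: contraT => n; exfalso.
  apply: (@cross _ _ (2%:R * (s - 2%:R * u) * minor a b 0 3
    - 2%:R * u * minor a b 0 2) n eZ).
  apply/eqP; rewrite -subr_eq0; apply/eqP.
  transitivity (2%:R * (s - 2%:R * u) * ((s - 2%:R * u) * (minor a b 0 2 ^+ 2
    + 2%:R * minor a b 0 3 ^+ 2) - 4%:R * u * minor a b 0 2 * minor a b 0 3)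
    - 2%:R * (s ^+ 2 - s * u - u ^+ 2) * minor a b 0 2 ^+ 2); first by ring.
  by rewrite eW F0; ring.
have m03 : minor a b 0 3 = 0.
  apply/eqP; apply: contraT => n; exfalso.
  apply: (@cross _ _ ((s - 2%:R * u) * minor a b 0 2
    - 2%:R * u * minor a b 0 3) n eV).
  apply/eqP; rewrite -subr_eq0; apply/eqP.
  transitivity ((s - 2%:R * u) * ((s - 2%:R * u) * (minor a b 0 2 ^+ 2
    + 2%:R * minor a b 0 3 ^+ 2) - 4%:R * u * minor a b 0 2 * minor a b 0 3)
    - 2%:R * (s ^+ 2 - s * u - u ^+ 2) * minor a b 0 3 ^+ 2); first by ring.
  by rewrite eW F0; ring.
have m12 : minor a b 1 2 = 0.
  by apply/eqP; rewrite -sqrf_eq0 eZ m02 expr0n /= mulr0.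
have m13 : minor a b 1 3 = 0.
  by apply/eqP; rewrite -sqrf_eq0 eV m03 expr0n /= mulr0.
have mN i j : minor a b i j = - minor a b j i by rewrite /minor; ring.
have mD i : minor a b i i = 0 by rewrite /minor; ring.
case=> [|[|[|[|//]]]] [|[|[|[|//]]]] _ _ //; rewrite mN ?m01 ?m02 ?m03 ?m12 ?m13 ?m23 ?mD oppr0 //.
Qed.

Lemma pencil_combination (R : comPzRingType) (N s u c d c' d' : R) (a b : nat -> R) :
  pencil N s u (fun k => c * a k + d * b k) (fun k => c' * a k + d' * b k) =
  c * c' * pencil N s u a a + (c * d' + d * c') * pencil N s u a b
  + d * d' * pencil N s u b b.
Proof. by rewrite /pencil; ring. Qed.

Lemma pencilZ (R : comPzRingType) (N s u d e : R) (a b a' b' : nat -> R) :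
  (forall k, (k < 5)%N -> d * a' k = a k) -> (forall k, (k < 5)%N -> e * b' k = b k) ->
  d * e * pencil N s u a' b' = pencil N s u a b.
Proof.
move=> ha hb; rewrite /pencil -!ha // -!hb //; ring.
Qed.

(** [f] is abstract, with just the bilinearity in use and dependence on five entries only, because
    it stands both for [pencil] and for the rescaled form at inert primes. *)
Lemma saturated_isotropic (f : (nat -> int) -> (nat -> int) -> int)
    (p : nat) (a b : nat -> int) :
  (forall c d c' d' a b, f (fun k => c * a k + d * b k) (fun k => c' * a k + d' * b k) =
     c * c' * f a a + (c * d' + d * c') * f a b + d * d' * f b b) ->
  (forall d e a b a' b', (forall k, (k < 5)%N -> d * a' k = a k) ->
     (forall k, (k < 5)%N -> e * b' k = b k) -> d * e * f a' b' = f a b) ->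
  prime p ->
  (exists i j, [/\ (i < 5)%N, (j < 5)%N & minor a b i j != 0]) -> isotropic f a b ->
  exists a' b', isotropic f a' b' /\
    exists i j, [/\ (i < 5)%N, (j < 5)%N & ~~ (p %| minor a' b' i j)%Z].
Proof.
move=> fC fZ pp nz [faa fab fbb].
have [a' [b' [[al [be [ga [de [d [d0 dab]]]]]] sat]]] := saturated_plane pp nz.
exists a', b'; split=> //.
have ha k (lk : (k < 5)%N) := (dab k lk).1; have hb k (lk : (k < 5)%N) := (dab k lk).2.
have zero x : d * d * x = 0 -> x = 0.
  by move/eqP; rewrite !mulf_eq0 (negbTE d0) => /eqP.
split; apply: zero.
- by rewrite (fZ _ _ _ _ _ _ ha ha) fC faa fab fbb; ring.
- by rewrite (fZ _ _ _ _ _ _ ha hb) fC faa fab fbb; ring.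
- by rewrite (fZ _ _ _ _ _ _ hb hb) fC faa fab fbb; ring.
Qed.

(** * The obstruction at 3 *)

Lemma F3_sqr (x : 'F_3) : x != 0 -> x ^+ 2 = 1.
Proof. by case: x => [[|[|[|//]]] i] // _; apply/val_inj. Qed.

(** Modulo 3 only the nondegenerate (x, y, w)-block survives, so a saturated isotropic plane
    contains a vector, nonzero modulo 3, with x, y, w divisible by 3. Its equation divided by 3
    leaves (s + u)(z^2 - v^2) - uzv = 0 modulo 3; the discriminant u^2 + 4(s + u)^2 = -1 is not a
    square, so 3 divides z and v as well. *)
Lemma no_plane_at_3 (N s u : int) (a b : nat -> int) :
  ~~ (3 %| N)%Z -> ~~ (3 %| u)%Z -> ~~ (3 %| s + u)%Z ->
  isotropic (pencil N s u) a b ->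
  (exists i j, [/\ (i < 5)%N, (j < 5)%N & minor a b i j != 0]) -> False.
Proof.
move=> N3 u3 su3 iso nz.
have p3 : prime 3 by [].
have {nz} := saturated_isotropic (pencil_combination N s u)
  (@pencilZ _ N s u) p3 nz iso; clear iso; clear a b.
move=> [a [b [iso [i [j [li lj nij]]]]]].
have [Paa Pab Pbb] := iso.
pose phi (x : int) : 'F_3 := x%:~R.
have phi0 x : (phi x == 0) = (3 %| x)%Z := Fp_intr_eq0 x p3.
have three : 3%:R = 0 :> 'F_3 by apply/val_inj.
pose I := [:: 0; 1; 4]%N.
pose A k := phi (a (nth 0%N I k)); pose B k := phi (b (nth 0%N I k)).
have red x y : phi (pencil N s u x y) =
    phi s * (phi (x 0%N) * phi (y 0%N) + phi (x 1%N) * phi (y 1%N))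
      + phi u * (2%:R * (phi (x 4) * phi (y 4)) - phi (x 0%N) * phi (y 0%N)
      - (phi (x 0%N) * phi (y 1%N) + phi (x 1%N) * phi (y 0%N))).
  rewrite -[RHS]addr0 -(mul0r (phi N * (phi s * (phi (x 2) * phi (y 2)
    + 2%:R * (phi (x 3) * phi (y 3))) - 2%:R * phi u * (phi (x 2) * phi (y 2)
    + phi (x 2) * phi (y 3) + phi (x 3) * phi (y 2) + 2%:R * (phi (x 3) * phi (y 3)))))).
  by rewrite -three /phi /pencil; ring.
have mABz := @ternary_isotropic _ (phi s) (phi u) A B.
have mAB : forall i j, (i < 3)%N -> (j < 3)%N -> minor A B i j = 0.
  apply: mABz; rewrite ?phi0 //.
  - have -> : phi s ^+ 2 - phi s * phi u - phi u ^+ 2 =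
        phi (s + u) ^+ 2 + phi u ^+ 2 - 3%:R * (phi u ^+ 2 + phi s * phi u).
      by rewrite /phi rmorphD; ring.
    rewrite three mul0r subr0 !F3_sqr ?phi0 //.
  - by split; rewrite /A /B /= -red ?Paa ?Pab ?Pbb.
have dep k l : k \in I -> l \in I -> (3 %| minor a b k l)%Z.
  move=> kI lI; rewrite -phi0 /minor.
  have := mAB (index k I) (index l I).
  rewrite /minor /A /B !nth_index // -[3%N]/(size I) !index_mem => /(_ kI lI) <-.
  by rewrite /phi rmorphB !rmorphM.
have [c [d [ncd hcd]]] := dependent_mod p3 dep.
pose L (k : nat) : int := c * a k + d * b k.
have L0 : (3 %| L 0%N)%Z by apply: hcd.
have L1 : (3 %| L 1%N)%Z by apply: hcd.
have L4 : (3 %| L 4%N)%Z by apply: hcd.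
have PL : pencil N s u L L = 0 by rewrite pencil_combination Paa Pab Pbb; ring.
have hC : (s - 2%:R * u) * (L 2%N ^+ 2 + 2%:R * L 3%N ^+ 2) - 4%:R * u * L 2%N * L 3%N
   \in dvdz 3.
  have [[x0 e0] [x1 e1] [x4 e4]] : [/\ exists x : int, L 0%N = x * 3, exists x : int, L 1%N = x * 3
     & exists x : int, L 4%N = x * 3].
    by split; apply/dvdzP.
  suff : (3 %| N * ((s - 2%:R * u) * (L 2%N ^+ 2 + 2%:R * L 3%N ^+ 2) - 4%:R * u * L 2%N * L 3%N))%Z.
    by rewrite dvdz_primeM // (negbTE N3).
  apply/dvdzP; exists (- (s * (x0 ^+ 2 + x1 ^+ 2)
     + u * (2%:R * x4 ^+ 2 - x0 ^+ 2 - 2%:R * x0 * x1))).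
  apply: (mulfI (_ : (3 : int) != 0)) => //.
  apply/eqP; rewrite -subr_eq0; apply/eqP; rewrite -PL /pencil e0 e1 e4; ring.
have Z0 : (3 %| L 2%N)%Z /\ (3 %| L 3%N)%Z.
  rewrite -!phi0.
  have e : phi (s + u) * (phi (L 2%N) ^+ 2 - phi (L 3%N) ^+ 2) - phi u * phi (L 2%N) * phi (L 3%N) = 0.
    have /eqP e : phi ((s - 2%:R * u) * (L 2%N ^+ 2 + 2%:R * L 3%N ^+ 2)
      - 4%:R * u * L 2%N * L 3%N) == 0 by rewrite phi0.
    transitivity ((phi s - 2%:R * phi u) * (phi (L 2%N) ^+ 2 + 2%:R * phi (L 3%N) ^+ 2)
       - 4%:R * phi u * phi (L 2%N) * phi (L 3%N)
       + 3%:R * (phi u * (phi (L 2%N) ^+ 2 + phi (L 3%N) ^+ 2 + phi (L 2%N) * phi (L 3%N))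
                 - phi s * phi (L 3%N) ^+ 2)); first by rewrite /phi rmorphD; ring.
    by rewrite three mul0r addr0 -[RHS]e /phi; ring.
  have [z0 | z0] := eqVneq (phi (L 2%N)) 0; have [v0 | v0] := eqVneq (phi (L 3%N)) 0 => //; exfalso.
  - move: e; rewrite z0 !(mulr0, mul0r, subr0) expr0n /= sub0r F3_sqr // => /eqP.
    by rewrite mulrN1 oppr_eq0 phi0 (negbTE su3).
  - move: e; rewrite v0 !(mulr0, subr0) expr0n /= subr0 F3_sqr // mulr1 => /eqP.
    by rewrite phi0 (negbTE su3).
  - move: e; rewrite !F3_sqr // subrr mulr0 sub0r => /eqP.
    by rewrite oppr_eq0 !mulf_eq0 (negbTE z0) (negbTE v0) phi0 (negbTE u3).
have Lall k : (k < 5)%N -> (3 %| L k)%Z.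
  by case: Z0 => ? ?; case: k => [|[|[|[|[|//]]]]].
have := combination_neq0_mod p3 nij ncd.
by rewrite -/(L i) -/(L j) !Lall.
Qed.

(** * The obstruction at primes inert in Q(sqrt -3) *)

Lemma Posz_expn (p e : nat) : Posz (p ^ e) = (p : int) ^+ e.
Proof. by elim: e => // e IHe; rewrite expnS PoszM IHe exprS. Qed.

(** Same scheme as at 3. The odd valuation is used to absorb p^(2e) into x and leave a coefficient
    of valuation exactly 1: modulo p there remains a quaternary form of discriminant -3, not a
    square, hence without isotropic plane. A vector of the plane whose first four coordinates vanish
    modulo p then has its fifth divisible by p too. *)
Lemma no_plane_at_inert (p : nat) (N s u : int) (a b : nat -> int) : prime p ->
  p != 2 -> p != 3 -> ~~ (p %| N)%Z -> coprimez s u ->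
  odd (logn p `|(s ^+ 2 - s * u - u ^+ 2)%R|) ->
  (forall t : int, ~~ (p %| t ^+ 2 + 3%:R)%Z) ->
  isotropic (pencil N s u) a b ->
  (exists i j, [/\ (i < 5)%N, (j < 5)%N & minor a b i j != 0]) -> False.
Proof.
move=> pp p2 p3 Np su ov nsq [Paa Pab Pbb] [i [j [li lj nij]]].
set F := s ^+ 2 - s * u - u ^+ 2 in ov.
have F0 : F != 0 by apply: contraTneq ov => ->; rewrite logn0.
have pF : (p %| F)%Z by rewrite dvdzE absz_nat; move: ov; rewrite lognE; case: and3P => // -[].
set e := (logn p `|F|)./2.
have eE : logn p `|F| = e.*2.+1 by rewrite -[LHS]odd_double_half ov.
have [f fE] : exists f : int, F = (p : int) ^+ e.*2.+1 * f.
  have /dvdzP[f ->] : ((p ^ e.*2.+1)%N %| F)%Z by rewrite dvdz_logn // eE.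
  by exists f; rewrite mulrC -Posz_expn.
have pf : ~~ (p %| f)%Z.
  apply/negP => /dvdzP[f' f'E]; have : (e.*2.+1 < logn p `|F|)%N.
    rewrite -dvdz_logn // fE f'E -Posz_expn; apply/dvdzP; exists f'.
    by rewrite [(p ^ e.*2.+2)%N]expnS PoszM; ring.
  by rewrite eE ltnn.
have nsu : ~~ ((p %| s)%Z && (p %| u)%Z).
  by rewrite -dvdz_gcd (eqP su) dvdz1 absz_nat; case: (p) pp => [|[|?]].
have ps : ~~ (p %| s)%Z.
  apply: contra nsu => ps; rewrite ps -(@dvdz_prime_pow p u 1) //.
  rewrite -rpredN; have -> : - u ^+ 2 = F - s * (s - u) by rewrite /F; ring.
  by rewrite rpredB // dvdz_mulr.
have pu : ~~ (p %| u)%Z.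
  apply: contra nsu => pu; rewrite pu andbT -(@dvdz_prime_pow p s 1) //.
  have -> : s ^+ 2 = F + u * (s + u) by rewrite /F; ring.
  by rewrite rpredD // dvdz_mulr.
have s0 : s != 0 by apply: contraNneq ps => ->; rewrite dvdz0.
(* In the coordinates (w, sy - ux, z, v, p^e x) the form s q is
   quaternary + p f X^2 with p not dividing f. *)
pose q5 (x y : nat -> int) := quaternary N s u x y + (p : int) * f * (x 4 * y 4).
pose T (x : nat -> int) k := nth 0 [:: x 4; s * x 1%N - u * x 0%N; x 2; x 3;
   (p : int) ^+ e * x 0%N] k : int.
have q5T x y : q5 (T x) (T y) = s * pencil N s u x y.
  rewrite /q5 /quaternary /T /=.
  transitivity (2%:R * u * s * (x 4 * y 4) + (s * x 1%N - u * x 0%N) * (s * y 1%N - u * y 0%N)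
     + 3%:R * N * s * ((s - 2%:R * u) * (x 2 * y 2 + 2%:R * (x 3 * y 3))
                    - 2%:R * u * (x 2 * y 3 + x 3 * y 2))
     + F * (x 0%N * y 0%N)).
    by rewrite fE exprS -addnn exprD; move: (_ ^+ e) => pe; ring.
  by rewrite /pencil /F; ring.
have pe0 : (p : int) ^+ e != 0 by rewrite expf_neq0 // -lt0n prime_gt0.
have nzT : exists i j, [/\ (i < 5)%N, (j < 5)%N & minor (T a) (T b) i j != 0].
  (* [D] times the inverse of [T]: coordinate k is read off at place [l k], and y needs in addition
     [T x 4] to undo the shift by ux. *)
  pose D := s * (p : int) ^+ e.
  pose l k := nth 0%N [:: 4; 1; 2; 3; 0]%N k.
  pose c1 k := nth 0 [:: s; (p : int) ^+ e; D; D; D] k.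
  pose c2 k := nth 0 [:: 0; u; 0; 0; 0] k.
  have DT (x : nat -> int) k : (k < 5)%N -> D * x k = c1 k * T x (l k) + c2 k * T x 4.
    by case: k => [|[|[|[|[|//]]]]] _; rewrite /c1 /c2 /l /T /D /=; ring.
  have D0 : D != 0 by rewrite mulf_neq0.
  have [/forallP allz | /forallPn[k /forallPn[m nkm]]] :=
      boolP [forall k : 'I_5, [forall m : 'I_5, minor (T a) (T b) k m == 0]].
    have mz k m : (k < 5)%N -> (m < 5)%N -> minor (T a) (T b) k m = 0.
      by move=> lk lm; apply/eqP; apply: (forallP (allz (Ordinal lk)) (Ordinal lm)).
    have lt5 k : (k < 5)%N -> (l k < 5)%N by case: k => [|[|[|[|[|//]]]]].
    case/negP: nij; rewrite -(inj_eq (mulfI D0)) -(inj_eq (mulfI D0)) !mulr0; apply/eqP.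
    transitivity ((D * a i) * (D * b j) - (D * a j) * (D * b i)).
      by rewrite /minor; ring.
    rewrite !DT //.
    transitivity (c1 i * c1 j * minor (T a) (T b) (l i) (l j)
      + c1 i * c2 j * minor (T a) (T b) (l i) 4
      + c2 i * c1 j * minor (T a) (T b) 4 (l j)
      + c2 i * c2 j * minor (T a) (T b) 4 4); first by rewrite /minor; ring.
    by rewrite !mz ?lt5 //; ring.
  by exists k, m; split.
have isoT : isotropic q5 (T a) (T b) by split; rewrite q5T ?Paa ?Pab ?Pbb mulr0.
have q5C c d c' d' (x y : nat -> int) :
    q5 (fun k => c * x k + d * y k) (fun k => c' * x k + d' * y k) =
    c * c' * q5 x x + (c * d' + d * c') * q5 x y + d * d' * q5 y y.
  by rewrite /q5 /quaternary; ring.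
have q5Z d d' (x y x' y' : nat -> int) : (forall k, (k < 5)%N -> d * x' k = x k) ->
    (forall k, (k < 5)%N -> d' * y' k = y k) -> d * d' * q5 x' y' = q5 x y.
  by move=> hx hy; rewrite /q5 /quaternary -!hx // -!hy //; ring.
have := saturated_isotropic q5C q5Z pp nzT isoT.
clear a b Paa Pab Pbb i j li lj nij nzT isoT.
move=> [a [b [[qaa qab qbb] [i [j [li lj nij]]]]]].
pose phi (x : int) : 'F_p := x%:~R.
have phi0 x : (phi x == 0) = (p %| x)%Z := Fp_intr_eq0 x pp.
have phip : phi p = 0 by apply/eqP; rewrite phi0 dvdzz.
have red x y : phi (q5 x y) =
    quaternary (phi N) (phi s) (phi u) (fun k => phi (x k)) (fun k => phi (y k)).
  rewrite -[RHS]addr0 -(mul0r (phi f * (phi (x 4%N) * phi (y 4%N)))) -phip.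
  by rewrite /phi /q5 /quaternary; ring.
have mAB := @quaternary_isotropic _ (phi N) (phi s) (phi u)
  (fun k => phi (a k)) (fun k => phi (b k)).
have dep k m : k \in iota 0 4 -> m \in iota 0 4 -> (p %| minor a b k m)%Z.
  rewrite !mem_iota !add0n => /andP[_ lk] /andP[_ lm].
  have {}mAB := mAB _ _ _ _ _ _ _ k m lk lm.
  rewrite -phi0; have -> : phi (minor a b k m)
      = minor (fun k => phi (a k)) (fun k => phi (b k)) k m.
    by rewrite /minor /phi; ring.
  apply/eqP; apply: mAB; rewrite ?phi0 //.
  - have -> : 6%:R = phi 6 by [].
    rewrite phi0 dvdzE absz_nat; apply/negP => p6.
    have : p \in primes 6 by rewrite mem_primes pp.
    by rewrite !inE (negbTE p2) (negbTE p3).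
  - have -> : phi s ^+ 2 - phi s * phi u - phi u ^+ 2 = phi F by rewrite /F /phi; ring.
    by apply/eqP; rewrite phi0.
  - move=> t; have := nsq (val t); rewrite -phi0; apply: contra => /eqP e3.
    rewrite /phi rmorphD rmorphXn /=.
    have -> : ((val t)%:Z)%:~R = t :> 'F_p by rewrite -pmulrn natr_Zp.
    by rewrite e3 addrC subrr.
  - by split; rewrite -red ?qaa ?qab ?qbb /phi.
have [c [d [ncd hcd]]] := dependent_mod pp dep.
pose L (k : nat) : int := c * a k + d * b k.
have L4 : (p %| L 4%N)%Z.
  have qL : q5 L L = 0 by rewrite q5C qaa qab qbb; ring.
  have hL k : k \in iota 0 4 -> exists x : int, L k = x * p by move/hcd/dvdzP.
  have [x0 e0] := hL 0%N isT; have [x1 e1] := hL 1%N isT.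
  have [x2 e2] := hL 2%N isT; have [x3 e3] := hL 3%N isT.
  have p0 : (p : int) != 0 by rewrite -lt0n prime_gt0.
  have : (p %| f * L 4%N ^+ 2)%Z.
    apply/dvdzP; exists (- quaternary N s u (fun k => nth 0 [:: x0; x1; x2; x3] k)
       (fun k => nth 0 [:: x0; x1; x2; x3] k)).
    apply: (mulfI p0); apply/eqP; rewrite -subr_eq0; apply/eqP; rewrite -qL.
    by rewrite /q5 /quaternary /= e0 e1 e2 e3; ring.
  by rewrite dvdz_primeM // (negbTE pf) dvdz_prime_pow.
have Lall k : (k < 5)%N -> (p %| L k)%Z.
  case: (ltnP k 4) => lk l5; first by apply: hcd; rewrite mem_iota.
  by have -> : k = 4 by apply/eqP; rewrite eqn_leq -ltnS l5.
have := combination_neq0_mod pp nij ncd.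
by rewrite -/(L i) -/(L j) !Lall.
Qed.

(** * The real obstruction *)

Lemma kernel_combination (x y : int) :
  exists c d : int, (c != 0) || (d != 0) /\ c * x + d * y = 0.
Proof.
have [-> | y0] := eqVneq y 0; first by exists 0, 1; split=> //; ring.
by exists y, (- x); rewrite y0; split=> //; ring.
Qed.

Lemma combination_neq0 (a b : nat -> int) (c d : int) i j :
  minor a b i j != 0 -> (c != 0) || (d != 0) ->
  (c * a i + d * b i != 0) || (c * a j + d * b j != 0).
Proof.
move=> nij; apply: contraTT; rewrite !negb_or !negbK => /andP[/eqP hi /eqP hj].
have hc : c * minor a b i j = 0.
  transitivity ((c * a i + d * b i) * b j - (c * a j + d * b j) * b i).
    by rewrite /minor; ring.
  by rewrite hi hj; ring.
have hd : d * minor a b i j = 0.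
  transitivity ((c * a j + d * b j) * a i - (c * a i + d * b i) * a j).
    by rewrite /minor; ring.
  by rewrite hi hj; ring.
by move/eqP: hc; move/eqP: hd; rewrite !mulf_eq0 (negbTE nij) !orbF => -> ->.
Qed.

Lemma sum4_sqr_eq0 (A B C D w x y z : int) : 0 < A -> 0 < B -> 0 < C -> 0 < D ->
  A * w ^+ 2 + B * x ^+ 2 + C * y ^+ 2 + D * z ^+ 2 = 0 ->
  [/\ w = 0, x = 0, y = 0 & z = 0].
Proof.
move=> A0 B0 C0 D0 e.
have nn (a t : int) : 0 < a -> 0 <= a * t ^+ 2 by move=> a0; rewrite mulr_ge0 ?sqr_ge0 // ltW.
have z0 (a t : int) : 0 < a -> a * t ^+ 2 = 0 -> t = 0.
  by move=> a0 /eqP; rewrite mulf_eq0 sqrf_eq0 gt_eqF //= => /eqP.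
move/eqP: e; rewrite !paddr_eq0 ?addr_ge0 ?nn // -!andbA.
case/and4P => /eqP hw /eqP hx /eqP hy /eqP hz.
by split; [exact: z0 hw | exact: z0 hx | exact: z0 hy | exact: z0 hz].
Qed.

(** If F > 0 and s > 0, some hyperplane carries a positive definite form, and every plane meets it
    in a nonzero vector: w = 0 for u < 0, z + v = 0 for u > 0. For u = 0 the form is semidefinite
    and its null vectors fill only the w-axis. *)
Lemma plane_disc_le0 (N s u : int) (a b : nat -> int) : 0 < N ->
  isotropic (pencil N s u) a b ->
  (exists i j, [/\ (i < 5)%N, (j < 5)%N & minor a b i j != 0]) ->
  s ^+ 2 - s * u - u ^+ 2 <= 0.
Proof.
move=> N0 iso [i [j [li lj nij]]]; rewrite leNgt; apply/negP => F0.
wlog s0 : s u iso F0 / 0 < s.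
  move=> W; case: (ltgtP s 0) => s0; last 2 first.
  - exact: (W s u).
  - by move: F0; rewrite s0 mul0r expr0n /= !sub0r oppr_gt0 ltNge sqr_ge0.
  apply: (W (- s) (- u)); rewrite ?oppr_gt0 ?sqrrN ?mulrNN //.
  have opp x y : pencil N (- s) (- u) x y = - pencil N s u x y by rewrite /pencil; ring.
  by case: iso => h1 h2 h3; split; rewrite opp ?h1 ?h2 ?h3 oppr0.
have [Paa Pab Pbb] := iso.
have PL c d : pencil N s u (fun k => c * a k + d * b k) (fun k => c * a k + d * b k) = 0.
  by rewrite pencil_combination Paa Pab Pbb; ring.
case: (ltP u 0) => u0.
  have [c [d [cd L4]]] := kernel_combination (a 4) (b 4).
  have := combination_neq0 nij cd.
  pose L (k : nat) : int := c * a k + d * b k; rewrite -/(L i) -/(L j).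
  have L40 : L 4 = 0 by [].
  pose x := L 0%N; pose y := L 1%N; pose z := L 2; pose v := L 3.
  pose sg := s - 2%:R * u.
  have e : sg * (s * y - u * x) ^+ 2 + sg * (s ^+ 2 - s * u - u ^+ 2) * x ^+ 2
     + 3%:R * N * s * (sg * z - 2%:R * u * v) ^+ 2
        + 6%:R * N * s * (sg ^+ 2 - 2%:R * u ^+ 2) * v ^+ 2 = 0.
    transitivity (sg * s * pencil N s u L L); last by rewrite PL mulr0.
    by rewrite /pencil L40 -/x -/y -/z -/v /sg; ring.
  have u1 : 0 < - u by rewrite oppr_gt0.
  have sg0 : 0 < sg by rewrite /sg -mulrN addr_gt0 ?mulr_gt0.
  have g0 : 0 < sg ^+ 2 - 2%:R * u ^+ 2.
    have -> : sg ^+ 2 - 2%:R * u ^+ 2 = s ^+ 2 + 4%:R * s * (- u) + 2%:R * (- u) ^+ 2.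
      by rewrite /sg; ring.
    by rewrite !addr_gt0 ?mulr_gt0 ?exprn_gt0.
  have [||||e1 x0 e2 v0] := sum4_sqr_eq0 _ _ _ _ e; rewrite ?mulr_gt0 //.
  have y0 : y = 0.
    by move/eqP: e1; rewrite x0 mulr0 subr0 mulf_eq0 gt_eqF //= => /eqP.
  have z0 : z = 0.
    by move/eqP: e2; rewrite v0 mulr0 subr0 mulf_eq0 gt_eqF //= => /eqP.
  have L0 k : (k < 5)%N -> L k = 0 by case: k => [|[|[|[|[|//]]]]].
  by rewrite !L0 ?eqxx.
have [u00 | u00] := eqVneq u 0.
  have only4 L : pencil N s u L L = 0 -> forall k, (k < 4)%N -> L k = 0.
    move=> PL0; have [|||||h0 h1 h2 h3] := @sum4_sqr_eq0 s s (3%:R * N * s) (6%:R * N * s)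
      (L 0%N) (L 1%N) (L 2) (L 3); rewrite ?mulr_gt0 //.
      by rewrite -[RHS]PL0 /pencil u00; ring.
    by case=> [|[|[|[|//]]]].
  have hA := only4 a Paa; have hB := only4 b Pbb.
  case/negP: nij; apply/eqP; rewrite /minor.
  case: (ltnP i 4) => li4; first by rewrite (hA i li4) (hB i li4); ring.
  case: (ltnP j 4) => lj4; first by rewrite (hA j lj4) (hB j lj4); ring.
  have -> : i = 4 by apply/eqP; rewrite eqn_leq -ltnS li.
  have -> : j = 4 by apply/eqP; rewrite eqn_leq -ltnS lj.
  by ring.
(* On z + v = 0 the (z, v)-part of the member becomes 3N(3s - 2u) v^2, and F > 0 forces 3s > 2u. *)
have [c [d [cd L23]]] := kernel_combination (a 2 + a 3) (b 2 + b 3).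
have := combination_neq0 nij cd.
pose L (k : nat) : int := c * a k + d * b k; rewrite -/(L i) -/(L j).
have zv : L 2 = - L 3 by apply/eqP; rewrite -addr_eq0 -[X in _ == X]L23; apply/eqP; rewrite /L; ring.
pose x := L 0%N; pose y := L 1%N; pose v := L 3; pose w := L 4.
have e : 2%:R * u * s * w ^+ 2 + 1 * (s * y - u * x) ^+ 2
   + (s ^+ 2 - s * u - u ^+ 2) * x ^+ 2
   + 3%:R * N * s * (3%:R * s - 2%:R * u) * v ^+ 2 = 0.
  transitivity (s * pencil N s u L L); last by rewrite PL mulr0.
  by rewrite /pencil zv -/x -/y -/v -/w; ring.
have u1 : 0 < u by rewrite lt_neqAle eq_sym u00.
have su0 : 0 < 3%:R * s - 2%:R * u.
  rewrite subr_gt0 ltNge; apply: contraTN F0 => h; rewrite -leNgt.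
  have us : s <= u by lra.
  have -> : s ^+ 2 - s * u - u ^+ 2 = - (s * (u - s) + u ^+ 2) by ring.
  by rewrite oppr_le0 addr_ge0 ?sqr_ge0 // mulr_ge0 ?subr_ge0 // ltW.
have [||||w0 e1 x0 v0] := sum4_sqr_eq0 _ _ _ _ e; rewrite ?mulr_gt0 //.
have y0 : y = 0.
  by move/eqP: e1; rewrite x0 mulr0 subr0 mulf_eq0 gt_eqF //= => /eqP.
have L0 k : (k < 5)%N -> L k = 0.
  by case: k => [|[|[|[|[|//]]]]] //; rewrite zv -/v v0 oppr0.
by rewrite !L0 ?eqxx.
Qed.

(** * Combining the local conditions *)

(** A square root x of -3 yields the primitive cube root of unity (x - 1)/2 in F_p; being fixed by
    the p-th power map, it excludes p = 2 mod 3. *)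
Lemma prime_dvd_sqrD3 (p : nat) (t : int) : prime p -> p != 2 -> p != 3 ->
  (p %| t ^+ 2 + 3%:R)%Z -> (p %% 3 = 1)%N.
Proof.
move=> pp p2 p3; rewrite -Fp_intr_eq0 // => /eqP e.
pose x : 'F_p := t%:~R.
have e' : x ^+ 2 + 3%:R = 0 by rewrite -[RHS]e /x; ring.
have nz k : prime k -> p != k -> k%:R != 0 :> 'F_p.
  move=> pk pnk; have := Fp_intr_eq0 k pp; rewrite -pmulrn => ->.
  by rewrite dvdzE !absz_nat dvdn_prime2.
pose om : 'F_p := (x - 1) / 2%:R.
have n2 : 2%:R != 0 :> 'F_p by apply: nz.
have om1 : om ^+ 2 + om + 1 = 0.
  apply: (mulfI n2); apply: (mulfI n2); rewrite !mulr0 -[RHS]e' /om; field.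
  exact: n2.
have om3 : om ^+ 3 = 1.
  apply/eqP; rewrite -subr_eq0; apply/eqP.
  transitivity ((om - 1) * (om ^+ 2 + om + 1)); first by ring.
  by rewrite om1 mulr0.
have om_neq1 : om != 1.
  apply: contra_eq_neq om1 => ->.
  have -> : 1 ^+ 2 + 1 + 1 = 3%:R :> 'F_p by ring.
  exact: nz.
have omp : om ^+ p = om by have := expf_card om; rewrite card_Fp.
have : (p %% 3 < 3)%N by rewrite ltn_mod.
case r : (p %% 3)%N => [|[|[|//]]] // _; exfalso.
  have : (3 %| p)%N by rewrite /dvdn r.
  by rewrite dvdn_prime2 // eq_sym (negbTE p3).
have e2 : om ^+ 2 = om.
  have omk k q : k = (3 * q + 2)%N -> om ^+ k = om ^+ 2.
    by move=> ->; rewrite exprD exprM om3 expr1n mul1r.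
  by rewrite -(omk p (p %/ 3)%N) ?omp // {1}(divn_eq p 3) r mulnC.
have om0 : om != 0.
  by apply/eqP => o; move/eqP: om3; rewrite o expr0n eq_sym (negbTE (oner_neq0 _)).
by case/negP: om_neq1; rewrite -(inj_eq (mulfI om0)) mulr1 -expr2 e2.
Qed.

Lemma mod3_of_even_inert (n : nat) : (0 < n)%N -> ~~ (3 %| n)%N ->
  (forall p, prime p -> odd (logn p n) -> p %% 3 = 1)%N -> (n %% 3 = 1)%N.
Proof.
have [m] := ubnP n; elim: m n => // m IH n ltnm n0 n3 hn.
have [n1 | n1] := leqP n 1; first by have -> : n = 1%N by apply/eqP; rewrite eqn_leq n1.
have [p pp pn] : exists2 p, prime p & (p %| n)%N by exists (pdiv n); rewrite ?pdiv_prime ?pdiv_dvd.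
have [k kp nE] := pfactor_coprime pp n0.
have lk : (0 < logn p n)%N by rewrite logn_gt0 mem_primes pp n0 pn.
have k0 : (0 < k)%N by move: n0; rewrite nE; case: (k).
have kn : (k < n)%N.
  rewrite [X in (_ < X)%N]nE -[X in (X < _)%N]muln1 ltn_pmul2l // -{1}(expn0 p) ltn_exp2l //.
  exact: prime_gt1.
have hk : (k %% 3 = 1)%N.
  apply: IH => //; first by apply: leq_trans kn _; rewrite -ltnS.
    by apply: contra n3 => k3; rewrite nE dvdn_mulr.
  move=> q pq oq; apply: hn => //.
  have pp0 : (0 < p ^ logn p n)%N by rewrite expn_gt0 prime_gt0.
  have -> : logn q n = (logn q k + logn p n * logn q p)%N.
    by rewrite {1}nE (lognM _ k0 pp0) lognX.
  case: (eqVneq q p) => [qp | qp]; last first.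
    by rewrite (logn_prime _ pp) (negbTE qp) muln0 addn0.
  move: oq; rewrite qp logn_coprime //.
have p3 : ~~ (3 %| p)%N.
  apply: contra n3 => h; rewrite nE dvdn_mull //.
  by apply: dvdn_trans h _; rewrite dvdn_exp.
rewrite nE -modnMml hk mul1n.
have p2 : (p ^ 2 %% 3 = 1)%N.
  rewrite -modnXm; move: p3; rewrite /dvdn.
  by have := ltn_pmod p (isT : 0 < 3)%N; case: (p %% 3)%N => [|[|[|]]].
have pe m' : ((p ^ 2) ^ m' %% 3 = 1)%N by rewrite -modnXm p2 exp1n.
rewrite -[X in (p ^ X)%N]odd_double_half expnD -mul2n expnM -modnMmr pe muln1.
by case o: (odd _) => //; rewrite expn1; apply: hn.
Qed.

(** The primes give |F| = 1 mod 3 and the reals F < 0, so F = -1 mod 3. As F = (s + u)^2 + u^2 mod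
    3, neither square vanishes, and this is what [no_plane_at_3] requires. *)
Lemma no_isotropic_plane (N : nat) (s u : int) (a b : nat -> int) : (0 < N)%N ->
  (forall p, prime p -> (p %| N)%N -> p %% 3 = 1)%N -> coprimez s u ->
  isotropic (pencil N%:R s u) a b ->
  (exists i j, [/\ (i < 5)%N, (j < 5)%N & minor a b i j != 0]) -> False.
Proof.
move=> N0 hN su iso nz.
have N3 : ~~ (3 %| (N%:R : int))%Z.
  by rewrite natz dvdzE !absz_nat; apply/negP => /(hN 3 isT).
set F := s ^+ 2 - s * u - u ^+ 2.
have Fle : F <= 0 by apply: plane_disc_le0 iso nz; rewrite ltr0n.
have ncop p : prime p -> (p %| s)%Z -> (p %| u)%Z -> False.
  move=> pp ps pu; have : (p %| gcdz s u)%Z by rewrite dvdz_gcd ps.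
  by rewrite (eqP su) dvdz1 absz_nat; case: (p) pp => [|[|?]].
(* The prime 2 is outside the scope of [no_plane_at_inert], but it never divides F: s^2 - su - u^2
   has no nontrivial zero modulo 2. *)
have Fodd : ~~ (2 %| F)%Z.
  pose phi (x : int) : 'F_2 := x%:~R.
  have phi0 x : (phi x == 0) = (2 %| x)%Z := @Fp_intr_eq0 2 x isT.
  rewrite -phi0; apply/negP => /eqP h2.
  have e : phi F = phi s ^+ 2 - phi s * phi u - phi u ^+ 2 by rewrite /F /phi; ring.
  have s0 : phi s = 0 -> phi u = 0 -> False.
    by move=> s0 u0; apply: (@ncop 2); rewrite // -phi0 ?s0 ?u0.
  have F2 (x : 'F_2) : x = 0 \/ x = 1.
    by case: x => [[|[|//]] ?]; [left | right]; apply/val_inj.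
  move: h2; rewrite e.
  have [hs | hs] := F2 (phi s); have [hu | hu] := F2 (phi u); rewrite hs hu.
  - by case: (s0 hs hu).
  - by move=> /(congr1 val).
  - by move=> /(congr1 val).
  - by move=> /(congr1 val).
have F0 : F != 0 by apply: contraNneq Fodd => ->; rewrite dvdz0.
have Flt : F < 0 by rewrite lt_neqAle F0.
pose phi (x : int) : 'F_3 := x%:~R.
have phi0 x : (phi x == 0) = (3 %| x)%Z := @Fp_intr_eq0 3 x isT.
have three : 3%:R = 0 :> 'F_3 by apply/val_inj.
have phiF : phi F = phi (s + u) ^+ 2 + phi u ^+ 2.
  rewrite -[RHS]subr0 -(mul0r (phi u ^+ 2 + phi s * phi u)) -three /F /phi; ring.
have F3 : ~~ (3 %| F)%Z.
  rewrite -phi0 phiF.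
  have [h1 | h1] := eqVneq (phi (s + u)) 0; have [h2 | h2] := eqVneq (phi u) 0.
  - exfalso; apply: (@ncop 3) => //; last by rewrite -phi0 h2.
    have -> : s = (s + u) - u by ring.
    by rewrite rpredB // -phi0 ?h1 ?h2.
  - by rewrite h1 expr0n add0r F3_sqr.
  - by rewrite h2 expr0n addr0 F3_sqr.
  - by rewrite !F3_sqr.
have res : (`|F| %% 3 = 1)%N.
  apply: mod3_of_even_inert => [||p pp op]; first by rewrite absz_gt0.
    by move: F3; rewrite dvdzE.
  have p2 : p != 2.
    apply: contraTneq op => ->; rewrite lognE /= absz_gt0 F0 /=.
    by move: Fodd; rewrite dvdzE => /negbTE->.
  have p3 : p != 3.
    apply: contraTneq op => ->; rewrite lognE /= absz_gt0 F0 /=.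
    by move: F3; rewrite dvdzE => /negbTE->.
  apply/eqP; apply: contraT => p1; exfalso.
  apply: (@no_plane_at_inert p N%:R s u a b) => // [|t].
    by rewrite natz dvdzE !absz_nat; apply: contra p1 => /(hN p pp)->.
  by apply: contra p1 => /(prime_dvd_sqrD3 pp p2 p3)->.
have phiF1 : phi F = - 1.
  have -> : F = - (`|F|%N : int) by rewrite abszE ltr0_norm // opprK.
  rewrite /phi rmorphN /=; congr (- _).
  rewrite (divn_eq `|F| 3) res PoszD PoszM rmorphD rmorphM /=.
  by rewrite -[(3 : int)%:~R]/(3%:R) three mulr0 add0r.
apply: (@no_plane_at_3 N%:R s u a b) => //; rewrite -phi0; apply/negP => /eqP h.
- move: phiF1; rewrite phiF h expr0n addr0 /=.
  have [-> | /F3_sqr->] := eqVneq (phi (s + u)) 0; first by rewrite expr0n => /eqP.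
  by move/eqP.
- move: phiF1; rewrite phiF h expr0n add0r /=.
  have [-> | /F3_sqr->] := eqVneq (phi u) 0; first by rewrite expr0n => /eqP.
  by move/eqP.
Qed.

(** * The surfaces and their smoothness *)

Definition i0 : 'I_5 := @Ordinal 5 0 isT.
Definition i1 : 'I_5 := @Ordinal 5 1 isT.
Definition i2 : 'I_5 := @Ordinal 5 2 isT.
Definition i3 : 'I_5 := @Ordinal 5 3 isT.
Definition i4 : 'I_5 := @Ordinal 5 4 isT.

Definition quad1 (N : nat) : {mpoly rat[5]} :=
  'X_i0 * 'X_i0 + 'X_i1 * 'X_i1
  + (3 * N)%:R * ('X_i2 * 'X_i2 + 2%:R * ('X_i3 * 'X_i3)).

Definition quad2 (N : nat) : {mpoly rat[5]} :=
  2%:R * ('X_i4 * 'X_i4) - 'X_i0 * 'X_i0 - 2%:R * ('X_i0 * 'X_i1)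
  - (6 * N)%:R * ('X_i2 * 'X_i2 + 2%:R * ('X_i2 * 'X_i3) + 2%:R * ('X_i3 * 'X_i3)).

Definition surface (N : nat) : quadric_pair := @QuadricPair 4 (quad1 N) (quad2 N).

Section Evaluation.

Variables (L : comNzRingType) (f : {rmorphism rat -> L}) (h : 'I_5 -> L).

Lemma mmap_var i : mmap f h 'X_i = h i.
Proof. by rewrite mmapX mmap1U. Qed.

Lemma mmap_quad1 N : mmap f h (quad1 N) = h i0 ^+ 2 + h i1 ^+ 2
  + 3%:R * N%:R * (h i2 ^+ 2 + 2%:R * h i3 ^+ 2).
Proof.
rewrite /quad1 natrM !(rmorphD, rmorphB, rmorphM, rmorph_nat) /= !mmap_var; ring.
Qed.

Lemma mmap_quad2 N : mmap f h (quad2 N) = 2%:R * h i4 ^+ 2 - h i0 ^+ 2 - 2%:R * h i0 * h i1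
  - 6%:R * N%:R * (h i2 ^+ 2 + 2%:R * h i2 * h i3 + 2%:R * h i3 ^+ 2).
Proof.
rewrite /quad2 natrM !(rmorphD, rmorphB, rmorphN, rmorphM, rmorph_nat) /= !mmap_var; ring.
Qed.

Lemma mmap_deriv_var j i : mmap f h ('X_i)^`M(j) = (i == j)%:R.
Proof.
rewrite mderivX mnm1E; case: eqVneq => [->|_]; last by rewrite scale0r rmorph0.
have -> : (U_(j) - U_(j))%MM = 0%MM :> 'X_{1..5} by apply/mnmP => k; rewrite !mnmE subnn.
by rewrite scale1r mmapX mmap11.
Qed.

Lemma mmap_derivM j (p q : {mpoly rat[5]}) : mmap f h (p * q)^`M(j)
  = mmap f h p^`M(j) * mmap f h q + mmap f h p * mmap f h q^`M(j).
Proof. by rewrite mderivM rmorphD !rmorphM. Qed.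

Lemma mmap_deriv_nat j n (p : {mpoly rat[5]}) :
  mmap f h (n%:R * p)^`M(j) = n%:R * mmap f h p^`M(j).
Proof. by rewrite mulr_natl mderivMn rmorphMn /= mulr_natl. Qed.

Lemma mmap_deriv_quad1 N j : mmap f h (quad1 N)^`M(j) =
  2%:R * ((i0 == j)%:R * h i0 + (i1 == j)%:R * h i1
   + 3%:R * N%:R * ((i2 == j)%:R * h i2 + 2%:R * ((i3 == j)%:R * h i3))).
Proof.
rewrite /quad1 natrM -mulrA !(mderivD, rmorphD) /= !mmap_deriv_nat !(mderivD, rmorphD) /=.
by rewrite !(mmap_deriv_nat, mmap_derivM, mmap_deriv_var, mmap_var); ring.
Qed.

Lemma mmap_deriv_quad2 N j : mmap f h (quad2 N)^`M(j) =
  4%:R * ((i4 == j)%:R * h i4) - 2%:R * ((i0 == j)%:R * h i0)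
  - 2%:R * ((i0 == j)%:R * h i1 + (i1 == j)%:R * h i0)
  - 12%:R * N%:R * ((i2 == j)%:R * h i2 + (i2 == j)%:R * h i3 + (i3 == j)%:R * h i2
                    + 2%:R * ((i3 == j)%:R * h i3)).
Proof.
rewrite /quad2 natrM -[_ * N%:R * _]mulrA !(mderivD, mderivN, rmorphD, rmorphN) /=.
rewrite !(mmap_deriv_nat, mderivD, mderivN, rmorphD, rmorphN) /=.
by rewrite !(mmap_deriv_nat, mmap_derivM, mmap_deriv_var, mmap_var); ring.
Qed.

End Evaluation.

Lemma quad1_homog N : quad1 N \is 2.-homog.
Proof.
have X2 i j : ('X_i * 'X_j : {mpoly rat[5]}) \is 2.-homog.
  by rewrite -mpolyXD dhomogX; apply/eqP; rewrite -[LHS]/(mdeg (U_(i) + U_(j))) mdegD !mdeg1.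
by rewrite /quad1 !mulr_natl !(rpredD, rpredMn).
Qed.

Lemma quad2_homog N : quad2 N \is 2.-homog.
Proof.
have X2 i j : ('X_i * 'X_j : {mpoly rat[5]}) \is 2.-homog.
  by rewrite -mpolyXD dhomogX; apply/eqP; rewrite -[LHS]/(mdeg (U_(i) + U_(j))) mdegD !mdeg1.
by rewrite /quad2 !mulr_natl !(rpredB, rpredD, rpredMn).
Qed.

Lemma surface_geom_point N (x : 'rV[algC]_5) : geom_point (X := surface N) x ->
  [/\ x != 0, x 0 i0 ^+ 2 + x 0 i1 ^+ 2 + 3%:R * N%:R * (x 0 i2 ^+ 2 + 2%:R * x 0 i3 ^+ 2) = 0
   & 2%:R * x 0 i4 ^+ 2 - x 0 i0 ^+ 2 - 2%:R * x 0 i0 * x 0 i1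
  - 6%:R * N%:R * (x 0 i2 ^+ 2 + 2%:R * x 0 i2 * x 0 i3 + 2%:R * x 0 i3 ^+ 2) = 0].
Proof.
by case=> x0 [] /=; rewrite (mmap_quad1 ratr) (mmap_quad2 ratr); split.
Qed.

Lemma forall_ord5 (P : 'I_5 -> Prop) :
  P i0 -> P i1 -> P i2 -> P i3 -> P i4 -> forall i, P i.
Proof.
move=> h0 h1 h2 h3 h4 [[|[|[|[|[|//]]]]] lt]; rewrite (bool_irrelevance lt isT).
exact: h0. exact: h1. exact: h2. exact: h3. exact: h4.
Qed.

(** A relation (l, m) between the rows of the Jacobian makes the point singular on l Q1 + m Q2. For
    m nonzero and t = l/m, w vanishes and the two blocks degenerate at t^2 - t - 1 = 0 and t^2 - 4t
    + 2 = 0, which share no root; at the vertices Q1 is (t^2 + 1) y^2 or 12 N v^2, hence nonzero. *)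
Lemma surface_smooth N : (0 < N)%N -> smooth (surface N).
Proof.
move=> N0 x /surface_geom_point [x0 q1 q2]; apply/eqP; rewrite -/(row_free _) -kermx_eq0.
apply/rowV0P => c /sub_kermxP cJ.
pose l := c 0 0; pose m := c 0 1.
have eqs j : l * mmap ratr (x 0) (quad1 N)^`M(j) + m * mmap ratr (x 0) (quad2 N)^`M(j) = 0.
  have := congr1 (fun M : 'rV_5 => M 0 j) cJ; rewrite !mxE !big_ord_recl big_ord0 addr0 !mxE /=.
  by move=> <-; congr (_ * _ + c 0 _ * _); apply/val_inj.
have Nn : N%:R != 0 :> algC by rewrite pnatr_eq0 -lt0n.
pose X := x 0 i0; pose Y := x 0 i1; pose Z := x 0 i2; pose V := x 0 i3; pose W := x 0 i4.
have xz : X = 0 -> Y = 0 -> Z = 0 -> V = 0 -> W = 0 -> False.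
  move=> *; case/negP: x0; apply/eqP/rowP; apply: forall_ord5; by rewrite mxE.
have n k : (k.+1)%:R != 0 :> algC by rewrite pnatr_eq0.
have eW : m * W = 0.
  apply: (mulfI (n 3%N)); rewrite mulr0 -[RHS](eqs i4) (mmap_deriv_quad1 ratr) (mmap_deriv_quad2 ratr).
  by rewrite /= /W; ring.
have eX : l * X = m * (X + Y).
  apply: (mulfI (n 1%N)); apply/eqP; rewrite -subr_eq0; apply/eqP.
  rewrite -[RHS](eqs i0) (mmap_deriv_quad1 ratr) (mmap_deriv_quad2 ratr) /= /X /Y; ring.
have eY : l * Y = m * X.
  apply: (mulfI (n 1%N)); apply/eqP; rewrite -subr_eq0; apply/eqP.
  rewrite -[RHS](eqs i1) (mmap_deriv_quad1 ratr) (mmap_deriv_quad2 ratr) /= /X /Y; ring.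
have eZ : l * Z = m * (2%:R * (Z + V)).
  apply: (mulfI (n 5%N)); apply: (mulfI Nn); apply/eqP; rewrite -subr_eq0; apply/eqP.
  rewrite -[RHS](eqs i2) (mmap_deriv_quad1 ratr) (mmap_deriv_quad2 ratr) /= /Z /V; ring.
have eV : l * V = m * (Z + 2%:R * V).
  apply: (mulfI (n 11%N)); apply: (mulfI Nn); apply/eqP; rewrite -subr_eq0; apply/eqP.
  rewrite -[RHS](eqs i3) (mmap_deriv_quad1 ratr) (mmap_deriv_quad2 ratr) /= /Z /V; ring.
have m0 : m = 0.
  apply/eqP; apply: contraT => mn; exfalso.
  have W0 : W = 0 by apply/eqP; move/eqP: eW; rewrite mulf_eq0 (negbTE mn).
  pose t := l / m.
  have div A B : l * A = m * B -> t * A = B.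
    by move=> e; apply: (mulfI mn); rewrite -e /t; field.
  have {}eX := div _ _ eX; have {}eY := div _ _ eY.
  have {}eZ := div _ _ eZ; have {}eV := div _ _ eV.
  have XE : X = t * Y by rewrite eY.
  have ZE : Z = (t - 2%:R) * V by rewrite mulrBl eV; ring.
  have tY : (t ^+ 2 - t - 1) * Y = 0.
    by move/eqP: eX; rewrite XE -subr_eq0 => /eqP <-; ring.
  have tV : (t ^+ 2 - 4%:R * t + 2%:R) * V = 0.
    by move/eqP: eZ; rewrite ZE -subr_eq0 => /eqP <-; ring.
  have [Y0 | Y0] := eqVneq Y 0; last first.
    move/eqP: tY; rewrite mulf_eq0 (negbTE Y0) orbF => /eqP t1.
    have V0 : V = 0.
      apply/eqP; apply: contraT => V0; exfalso.
      move/eqP: tV; rewrite mulf_eq0 (negbTE V0) orbF => /eqP t2.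
      have t3 : 3%:R * (1 - t) = 0.
        by rewrite -[RHS](subrr 0) -[in X in _ = X - _]t2 -[in X in _ = _ - X]t1; ring.
      move/eqP: t3; rewrite mulf_eq0 (negbTE (n 2%N)) /= subr_eq0 => /eqP t4.
      by move/eqP: t1; rewrite -t4 expr1n subrr sub0r oppr_eq0 oner_eq0.
    have Z0 : Z = 0 by rewrite ZE V0 mulr0.
    have e : (t ^+ 2 + 1) * Y ^+ 2 = 0.
      rewrite -[RHS]q1 -/X -/Y -/Z -/V Z0 V0 XE; ring.
    move/eqP: e; rewrite mulf_eq0 sqrf_eq0 (negbTE Y0) orbF => /eqP t2.
    have t3 : t = - 2%:R.
      apply/eqP; rewrite -subr_eq0 opprK; apply/eqP.
      by rewrite -[RHS](subrr 0) -[in X in _ = X - _]t2 -[in X in _ = _ - X]t1; ring.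
    have : 5%:R = 0 :> algC by rewrite -[RHS]t2 t3; ring.
    by apply/eqP; exact: (n 4%N).
  have X0 : X = 0 by rewrite XE Y0 mulr0.
  have V0 : V = 0.
    apply/eqP; apply: contraT => V0; exfalso.
    move/eqP: tV; rewrite mulf_eq0 (negbTE V0) orbF => /eqP t2.
    have e : 12%:R * N%:R * V ^+ 2 = 0.
      rewrite -[RHS]q1 -/X -/Y -/Z -/V X0 Y0 ZE.
      transitivity (12%:R * N%:R * V ^+ 2 + 3%:R * N%:R * (t ^+ 2 - 4%:R * t + 2%:R) * V ^+ 2);
        last by ring.
      by rewrite t2; ring.
    by move/eqP: e; rewrite !mulf_eq0 (negbTE (n 11%N)) (negbTE Nn) (negbTE V0).
  by apply: xz => //; rewrite ZE V0 mulr0.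
have l0 : l = 0.
  apply/eqP; apply: contraT => ln; exfalso.
  have kill A : l * A = 0 -> A = 0 by move/eqP; rewrite mulf_eq0 (negbTE ln) => /eqP.
  have X0 : X = 0 by apply: kill; rewrite eX m0 mul0r.
  have Y0 : Y = 0 by apply: kill; rewrite eY m0 mul0r.
  have Z0 : Z = 0 by apply: kill; rewrite eZ m0 mul0r.
  have V0 : V = 0 by apply: kill; rewrite eV m0 mul0r.
  apply: xz => //; apply/eqP; rewrite -sqrf_eq0; apply/eqP; apply: (mulfI (n 1%N)).
  by rewrite mulr0 -[RHS]q2 -/X -/Y -/Z -/V -/W X0 Y0 Z0 V0; ring.
apply/rowP => j; rewrite mxE; case: j => [[|[|//]] lt].
  by rewrite -[RHS]l0 /l; congr (c 0 _); apply/val_inj.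
by rewrite -[RHS]m0 /m; congr (c 0 _); apply/val_inj.
Qed.

(** * Complete intersection *)

(** Inverse of [muni]: it reassembles a polynomial in w whose coefficients involve the other four
    variables. *)
Definition mpoly_of_poly (p : {poly {mpoly rat[4]}}) : {mpoly rat[5]} :=
  (map_poly (@mwiden 4 rat) p).['X_ord_max].

Lemma ord5_cases (i : 'I_5) : (exists j : 'I_4, i = widen_ord (leqnSn 4) j) \/ i = ord_max.
Proof.
case: (ltnP i 4) => li; [left | right].
  by exists (Ordinal li); apply/val_inj.
by apply/val_inj/eqP; rewrite eqn_leq /= li -ltnS ltn_ord.
Qed.

Lemma mpoly_of_polyK (p : {mpoly rat[5]}) : mpoly_of_poly (muni p) = p.
Proof.
rewrite [RHS]mpolyE muniE /mpoly_of_poly rmorph_sum /= horner_sum; apply: eq_bigr => m _.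
rewrite map_polyZ map_polyXn hornerZ hornerXn /= mwidenZ mwidenX -scalerAl; congr (_ *: _).
rewrite mpolyXn -mpolyXD; congr 'X_[_]; apply/mnmP => i; rewrite mnmDE mulmnE mnm1E.
have [[j ->] | ->] := ord5_cases i.
  rewrite mnmwiden_widen mnmE -val_eqE /= (gtn_eqF (ltn_ord j)) addn0.
  by congr (m _); apply/val_inj.
by rewrite mnmwiden_ordmax eqxx mul1n.
Qed.

Lemma mpoly_of_polyM p q : mpoly_of_poly (p * q) = mpoly_of_poly p * mpoly_of_poly q.
Proof. by rewrite /mpoly_of_poly rmorphM hornerM. Qed.

Lemma mpoly_of_polyD p q : mpoly_of_poly (p + q) = mpoly_of_poly p + mpoly_of_poly q.
Proof. by rewrite /mpoly_of_poly rmorphD hornerD. Qed.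

Lemma muni_eqM (f g p q : {mpoly rat[5]}) :
  f * p = g * q -> muni f * muni p = muni g * muni q.
Proof.
move=> e.
have h := congr1 (@muni 4 rat) e.
rewrite (rmorphM (@muni 4 rat) f p) in h.
rewrite (rmorphM (@muni 4 rat) g q) in h.
exact h.
Qed.

Lemma muni_var_const (i : 'I_5) : (i < 4)%N -> exists c, muni ('X_i : {mpoly rat[5]}) = c%:P.
Proof.
move=> li; rewrite /muni mmapX mmap1U; case: splitP => j e; first by exists 'X_j.
by move: li; rewrite -[nat_of_ord i]/(nat_of_ord (cast_ord (esym (addn1 4)) i)) e ltnNge leq_addr.
Qed.

Lemma muni_var_max : muni ('X_ord_max : {mpoly rat[5]}) = 'X.
Proof.
rewrite /muni mmapX mmap1U; case: splitP => j //= e.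
by have := ltn_ord j; rewrite -e ltnn.
Qed.

Lemma rmorph_quad2 (R : comNzRingType) (phi : {rmorphism {mpoly rat[5]} -> R}) N :
  phi (quad2 N) = 2%:R * (phi 'X_i4 * phi 'X_i4) - phi 'X_i0 * phi 'X_i0
    - 2%:R * (phi 'X_i0 * phi 'X_i1)
    - (6 * N)%:R * (phi 'X_i2 * phi 'X_i2 + 2%:R * (phi 'X_i2 * phi 'X_i3)
                    + 2%:R * (phi 'X_i3 * phi 'X_i3)).
Proof.
by rewrite /quad2 !(rmorph_nat phi, rmorphD phi, rmorphN phi, rmorphM phi).
Qed.

(** Divide g by the monic d = X^2 + D, with quotient q and remainder r: then (k f - C q) d = C r,
    and the degrees force both sides to vanish. No division in R is needed. *)
Lemma monic_quadratic_regular (R : comNzRingType) (C D : R) (k f g : {poly R}) :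
  f * (k * ('X^2 + D%:P)) = g * C%:P -> exists q, k * f = C%:P * q.
Proof.
move=> e; pose d : {poly R} := 'X^2 + D%:P.
have sD : (size D%:P < size ('X^2 : {poly R}))%N by rewrite size_polyXn size_polyC; case: (_ != 0).
have dm : d \is monic by rewrite monicE lead_coefDl // lead_coefXn.
have sd : size d = 3%N by rewrite size_polyDl // size_polyXn.
have gE := Pdiv.RingMonic.rdivp_eq dm g.
set q := Pdiv.CommonRing.rdivp _ _ in gE; set r := Pdiv.CommonRing.rmodp _ _ in gE.
have rd : (size r < size d)%N by rewrite Pdiv.CommonRing.ltn_rmodp monic_neq0.
have eM : (k * f - C%:P * q) * d = C%:P * r.
  apply/eqP; rewrite -subr_eq0; move/eqP: e; rewrite -subr_eq0 gE -/d => /eqP <-; apply/eqP.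
  by clear gE rd dm sd; clearbody q r; clearbody d; ring.
exists q; apply/eqP; rewrite -subr_eq0; apply: contraT => nz.
have : (size (C%:P * r)%R < size d)%N.
  by rewrite mul_polyC; apply: leq_ltn_trans (size_scale_leq _ _) rd.
rewrite -eM size_Mmonic // sd addnC /= ltnNge.
by move: nz; rewrite -size_poly_gt0; case: (size _).
Qed.

(* quad1 does not involve the last variable, in which quad2 is monic up to a unit. *)
Lemma surface_complete_intersection N : complete_intersection (surface N).
Proof.
rewrite /complete_intersection /=; split.
  apply/eqP => q0; pose h i : rat := if i == i0 then 1 else 0.
  have := mmap_quad1 idfun h N; rewrite q0 rmorph0 /h /= => /eqP.
  by rewrite !expr0n /= expr1n !(mulr0, addr0) eq_sym oner_eq0.
move=> f g e.
have [c0 e0] := @muni_var_const i0 isT; have [c1 e1] := @muni_var_const i1 isT.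
have [c2 e2] := @muni_var_const i2 isT; have [c3 e3] := @muni_var_const i3 isT.
have e4 : muni ('X_i4 : {mpoly rat[5]}) = 'X.
  by rewrite -muni_var_max; congr (muni 'X__); apply/val_inj.
have [C eC] : exists C, muni (quad1 N) = C%:P.
  exists (c0 * c0 + c1 * c1 + (3 * N)%:R * (c2 * c2 + 2%:R * (c3 * c3))).
  by rewrite /quad1 !(rmorphD, rmorphM, rmorph_nat) /= e0 e1 e2 e3.
have [E eE] : exists E, muni (quad2 N) = 2%:R * ('X * 'X) + E%:P.
  exists (- (c0 * c0) - 2%:R * (c0 * c1)
    - (6 * N)%:R * (c2 * c2 + 2%:R * (c2 * c3) + 2%:R * (c3 * c3))).
  have -> : muni (quad2 N) = 2%:R * (muni 'X_i4 * muni 'X_i4) - muni 'X_i0 * muni 'X_i0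
    - 2%:R * (muni 'X_i0 * muni 'X_i1)
    - (6 * N)%:R * (muni 'X_i2 * muni 'X_i2 + 2%:R * (muni 'X_i2 * muni 'X_i3)
                    + 2%:R * (muni 'X_i3 * muni 'X_i3)) := rmorph_quad2 _ N.
  rewrite e0 e1 e2 e3 e4.
  have nE n : (n%:R : {poly {mpoly rat[4]}}) = (n%:R)%:P by rewrite polyC_natr.
  rewrite !nE; move: (2%:R) ((6 * N)%:R) => k2 k6.
  by rewrite !(polyCM, polyCD, polyCN) -!addrA.
have [D eD] : exists D, muni (quad2 N) = 2%:R * ('X^2 + D%:P).
  exists (2%:R^-1 *: E); rewrite eE expr2 mulrDr; congr (_ + _).
  rewrite -[X in X * _](rmorph_nat (@polyC {mpoly rat[4]})) -rmorphM mulr_natl.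
  by rewrite -scaler_nat scalerA divff ?scale1r.
have [q fE] : exists q, 2%:R * muni f = C%:P * q.
  have /monic_quadratic_regular h : muni f * (2%:R * ('X^2 + D%:P)) = muni g * C%:P.
    rewrite -eD -eC; move: (quad1 N) (quad2 N) e => p1 p2 e; exact: muni_eqM e.
  exact: h.
exists (2%:R^-1 *: mpoly_of_poly q).
have : mpoly_of_poly (2%:R * muni f) = quad1 N * mpoly_of_poly q.
  by rewrite fE mpoly_of_polyM -eC mpoly_of_polyK.
rewrite mulr_natl mulr2n mpoly_of_polyD !mpoly_of_polyK -mulr2n => e'.
by rewrite -scalerAl mulrC -e' -scaler_nat scalerA mulVf ?scale1r.
Qed.

Lemma surface_smooth_intersection N : (0 < N)%N ->
  smooth_intersection_of_two_quadrics (surface N).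
Proof.
move=> N0; split; [exact: quad1_homog | exact: quad2_homog | | exact: surface_smooth].
exact: surface_complete_intersection.
Qed.

(** * Degrees of closed points are even *)

(** The minimal polynomial of a primitive element has odd degree, hence a real root. The resulting
    real embedding of L is encoded by two morphisms out of Q[X], [phi] onto L and [psi] to the
    reals, where [psi] kills the kernel of [phi]. *)
Lemma odd_degree_real (L : fieldExtType rat) : odd (\dim {: L}) ->
  exists (phi : {rmorphism {poly rat} -> L}) (psi : {rmorphism {poly rat} -> realalg}),
    (forall x, exists p, phi p = x) /\ (forall p, phi p = 0 -> psi p = 0).
Proof.
move=> oddL; pose z := separable_generator 1%AS {: L}%AS.
have zE : {: L}%VS = <<1; z>>%VS.
  apply: (@eq_adjoin_separable_generator _ _ {:L}%AS 1%AS); last exact: subvf.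
  by apply/separableP => x _; apply: pcharf0_separable => q; rewrite pchar_lalg pchar_num.
have [p pE] := polyOver1P (minPolyOver 1%AS z).
have sp : size p = (\dim {: L}).+1.
  rewrite -(size_map_poly (in_alg L)) -pE size_minPoly zE (dim_Fadjoin 1%AS) dimv1 muln1 //.
have /odd_poly_root[r pr] : ~~ odd (size (map_poly (ratr : rat -> realalg) p)).
  by rewrite size_map_poly sp /= oddL.
exists (horner_alg z), (horner_eval r \o map_poly ratr : {rmorphism _ -> _}); split.
  move=> x; have : x \in <<1; z>>%VS by rewrite -zE memvf.
  by case/Fadjoin1_polyP => q ->; exists q.
move=> q q0; have : map_poly (in_alg L) p %| map_poly (in_alg L) q.
  by rewrite -pE minPoly_dvdp ?alg_polyOver //; apply/rootP.
rewrite dvdp_map => /dvdpP[q' ->]; rewrite /= /horner_eval rmorphM hornerM (rootP pr) mulr0 //.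
Qed.

Lemma surface_even_degree N (P : closed_point (surface N)) : (0 < N)%N -> (2 %| cp_degree P)%N.
Proof.
move=> N0; rewrite /cp_degree; case: P => L c exj onX gen /= {gen}.
case: exj onX => j cj [q1 q2]; rewrite dvdn2; apply/negP => oddL.
have [phi [psi [phi_surj phi0]]] := odd_degree_real oddL.
have [p pE] : exists p : 'I_5 -> {poly rat}, forall i, phi (p i) = c i.
  by apply: (@fin_all_exists _ _ (fun i p => phi p = c i)) => i.
have e1 : phi (p i0 ^+ 2 + p i1 ^+ 2 + 3%:R * N%:R * (p i2 ^+ 2 + 2%:R * p i3 ^+ 2)) = 0.
  by rewrite !(rmorph_nat phi, rmorphXn phi, rmorphD phi, rmorphM phi) !pE -(mmap_quad1 (in_alg L)).
have e2 : phi (2%:R * p i4 ^+ 2 - p i0 ^+ 2 - 2%:R * p i0 * p i1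
  - 6%:R * N%:R * (p i2 ^+ 2 + 2%:R * p i2 * p i3 + 2%:R * p i3 ^+ 2)) = 0.
  by rewrite !(rmorph_nat phi, rmorphXn phi, rmorphN phi, rmorphD phi, rmorphM phi) !pE
    -(mmap_quad2 (in_alg L)).
move/phi0: e1; move/phi0: e2.
rewrite !(rmorph_nat psi, rmorphXn psi, rmorphN psi, rmorphD psi, rmorphM psi) => e2 e1.
have N0' : 0 < N%:R :> realalg by rewrite ltr0n.
have [z0 z1 z2 z3] : [/\ psi (p i0) = 0, psi (p i1) = 0, psi (p i2) = 0 & psi (p i3) = 0].
  have [h0 h1 h2 h3] := And4 (sqr_ge0 (psi (p i0))) (sqr_ge0 (psi (p i1)))
    (sqr_ge0 (psi (p i2))) (sqr_ge0 (psi (p i3))).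
  move: (psi (p i0)) (psi (p i1)) (psi (p i2)) (psi (p i3)) e1 h0 h1 h2 h3 => x y z v e1 h0 h1 h2 h3.
  have hz := mulr_ge0 (ltW N0') h2.
  have hv := mulr_ge0 (ltW N0') h3.
  have x0 : x ^+ 2 = 0 by lra.
  have y0 : y ^+ 2 = 0 by lra.
  have zz : N%:R * z ^+ 2 = 0 by lra.
  have vv : N%:R * v ^+ 2 = 0 by lra.
  have N2 (t : realalg) : N%:R * t ^+ 2 = 0 -> t = 0.
    by move/eqP; rewrite mulf_eq0 (gt_eqF N0') sqrf_eq0 => /eqP.
  split; [exact/eqP/(etrans (esym (sqrf_eq0 _)))/eqP | | exact: N2 | exact: N2].
  exact/eqP/(etrans (esym (sqrf_eq0 _)))/eqP.
have z4 : psi (p i4) = 0.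
  move: e2; rewrite z0 z1 z2 z3 !(expr0n, mulr0, oppr0, addr0) /= => /eqP.
  by rewrite mulf_eq0 pnatr_eq0 /= sqrf_eq0 => /eqP.
have : psi (p j - 1) = 0 by apply: phi0; rewrite rmorphB rmorph1 pE cj subrr.
have -> : psi (p j - 1) = psi (p j) - 1 by rewrite rmorphB rmorph1.
suff -> : psi (p j) = 0 by move/eqP; rewrite sub0r oppr_eq0 oner_eq0.
have h : forall i, psi (p i) = 0 by apply: forall_ord5.
exact: h.
Qed.

(** * No closed point of degree 2 *)

Lemma common_denominator (n : nat) (a : nat -> rat) :
  exists (d : int) (a' : nat -> int), d != 0 /\ forall k, (k < n)%N -> (a' k)%:~R = d%:~R * a k.
Proof.
elim: n => [|n [d [a' [d0 h]]]]; first by exists 1, (fun=> 0).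
exists (d * denq (a n)).
exists (fun k => if (k < n)%N then a' k * denq (a n) else d * numq (a n)); split.
  by rewrite mulf_neq0 ?denq_neq0.
move=> k; rewrite ltnS leq_eqVlt => /orP[/eqP -> | kn].
  by rewrite ltnn !intrM -mulrA; congr (_ * _); rewrite numqE mulrC.
by rewrite kn !intrM h //; ring.
Qed.

Lemma coprime_pair (s u : int) : (s != 0) || (u != 0) ->
  exists d s' u' : int, [/\ d != 0, s = d * s', u = d * u' & coprimez s' u'].
Proof.
move=> su; have g0 : gcdz s u != 0 by rewrite gcdz_eq0 negb_and.
exists (gcdz s u), (s %/ gcdz s u)%Z, (u %/ gcdz s u)%Z.
have es := divzK (dvdz_gcdl s u); have eu := divzK (dvdz_gcdr s u).
split => //; try by rewrite mulrC.
apply/coprimezP; have [v [w e]] := Bezoutz s u; exists (v, w) => /=.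
by apply: (mulIf g0); rewrite mul1r mulrDl -!mulrA es eu.
Qed.

Lemma rmorph_pencil (R S : comPzRingType) (f : {rmorphism R -> S}) (N s u : R) (a b : nat -> R) :
  f (pencil N s u a b) = pencil (f N) (f s) (f u) (f \o a) (f \o b).
Proof. by rewrite /pencil !(rmorph_nat, rmorphN f, rmorphD f, rmorphM f). Qed.

Lemma pencil_member (R : comPzRingType) (N s u : R) (a b : nat -> R) :
  pencil N s u a b = s * pencil N 1 0 a b + u * pencil N 0 1 a b.
Proof. by rewrite /pencil; ring. Qed.

Lemma pencil_extension (R : comPzRingType) (N s u w t n : R) (a b : nat -> R) :
  w ^+ 2 = t * w + n ->
  pencil N s u (fun k => a k + b k * w) (fun k => a k + b k * w) =
  (pencil N s u a a + n * pencil N s u b b)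
  + (2%:R * pencil N s u a b + t * pencil N s u b b) * w.
Proof.
move=> e; rewrite (_ : pencil N s u _ _ = pencil N s u a a + 2%:R * pencil N s u a b * w
  + pencil N s u b b * w ^+ 2); first by rewrite e; ring.
by rewrite /pencil; ring.
Qed.

Lemma rmorph_pencil_extension (R S : comPzRingType) (f : {rmorphism R -> S}) (N : nat) (s u t n : R)
    (w : S) (a b : nat -> R) : w ^+ 2 = f t * w + f n ->
  pencil N%:R (f s) (f u) (fun k => f (a k) + f (b k) * w) (fun k => f (a k) + f (b k) * w) =
  f (pencil N%:R s u a a + n * pencil N%:R s u b b)
  + f (2%:R * pencil N%:R s u a b + t * pencil N%:R s u b b) * w.
Proof.
move=> e; rewrite (pencil_extension _ _ _ _ _ e).
rewrite (rmorphD f (pencil _ _ _ _ _)) (rmorphD f (2%:R * _)) !(rmorphM f) !(rmorph_pencil f).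
by rewrite !(rmorph_nat f).
Qed.

Lemma no_rational_plane (N : nat) (s u : rat) (a b : nat -> rat) : (0 < N)%N ->
  (forall p, prime p -> (p %| N)%N -> (p %% 3 = 1)%N) -> (s != 0) || (u != 0) ->
  isotropic (pencil N%:R s u) a b ->
  (exists i j, [/\ (i < 5)%N, (j < 5)%N & minor a b i j != 0]) -> False.
Proof.
move=> N0 Np su [aa ab bb] [i [j [li lj mij]]].
have [d [a' [d0 ha]]] := common_denominator 5 a.
have [e [b' [e0 hb]]] := common_denominator 5 b.
have [f [su' [f0 hsu]]] := common_denominator 2 (fun k => if k is 0%N then s else u).
have /coprime_pair[g [s' [u' [g0 es eu co]]]] : (su' 0%N != 0) || (su' 1%N != 0).
  by rewrite -!(intr_eq0 rat) !hsu // !mulf_eq0 !(intr_eq0 rat) (negbTE f0).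
have es' : g%:~R * s'%:~R = f%:~R * s :> rat by rewrite -intrM -es hsu.
have eu' : g%:~R * u'%:~R = f%:~R * u :> rat by rewrite -intrM -eu hsu.
have key x y x' y' (dx dy : int) : (forall k, (k < 5)%N -> (x' k)%:~R = dx%:~R * x k) ->
    (forall k, (k < 5)%N -> (y' k)%:~R = dy%:~R * y k) -> pencil N%:R s u x y = 0 ->
    pencil N%:R s' u' x' y' = 0.
  move=> hx hy xy; apply/eqP; rewrite -(intr_eq0 rat) (rmorph_pencil intr) rmorph_nat.
  suff /eqP : g%:~R * pencil N%:R s'%:~R u'%:~R (intr \o x') (intr \o y') = 0 :> rat.
    by rewrite mulf_eq0 (intr_eq0 rat) (negbTE g0).
  rewrite -(@pencilZ _ _ _ _ dx%:~R dy%:~R _ _ x y) => [|k lk|k lk]; last 2 first.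
  - exact: esym (hx k lk).
  - exact: esym (hy k lk).
  rewrite pencil_member; rewrite pencil_member in xy.
  rewrite mulrCA mulrDr !mulrA es' eu' -!mulrA -mulrDr xy; ring.
apply: (no_isotropic_plane N0 Np co) (_ : isotropic _ a' b') _.
  by split; [exact: (key a a _ _ d d) | exact: (key a b _ _ d e) | exact: (key b b _ _ e e)].
exists i, j; split=> //; rewrite -(intr_eq0 rat) /minor intrB !intrM !ha // !hb //.
have -> : d%:~R * a i * (e%:~R * b j) - d%:~R * a j * (e%:~R * b i)
  = d%:~R * e%:~R * minor a b i j :> rat by rewrite /minor; ring.
by rewrite !mulf_neq0 ?(intr_eq0 rat).
Qed.

Lemma quadratic_extension_coord (L : fieldExtType rat) (w : L) : \dim {: L} = 2%N ->
  w \notin 1%VS ->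
  (forall x : L, exists a b : rat, x = in_alg L a + in_alg L b * w) /\
  (forall a b : rat, in_alg L a + in_alg L b * w = 0 -> a = 0 /\ b = 0).
Proof.
move=> dL w1.
have fr : free [:: w; 1] by rewrite free_cons seq1_free oner_eq0 span_seq1 andbT.
split.
  have sp : <<[:: w; 1%R]>>%VS = {: L}%VS.
    by apply/eqP; rewrite eqEdim subvf dL (eqP fr).
  move=> x; have : x \in <<[:: w; 1%R]>>%VS by rewrite sp memvf.
  rewrite span_cons span_seq1 => /memv_addP[_ /vlineP[b ->] [_ /vlineP[a ->] ->]].
  by exists a, b; rewrite /= addrC -scalerAl mul1r.
move=> a b e; have b0 : b = 0.
  apply/eqP; apply: contraNT w1 => b0.
  have -> : w = in_alg L (- a / b).
    apply: (mulfI (_ : in_alg L b != 0)); first by rewrite fmorph_eq0.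
    have eb : b * (- a / b) = - a by field.
    rewrite -(rmorphM (in_alg L) b) eb rmorphN; apply/eqP; rewrite -addr_eq0 addrC.
    exact/eqP.
  by rewrite /= rpredZ ?rpred1.
by split=> //; move/eqP: e; rewrite b0 rmorph0 mul0r addr0 fmorph_eq0 => /eqP.
Qed.

Definition coordn (T : Type) (c : 'I_5 -> T) (k : nat) : T := c (inord k).

Lemma on_surface_pencil (L : comNzRingType) (f : {rmorphism rat -> L}) N (c : 'I_5 -> L) :
  on_forms f (X := surface N) c ->
  forall s u, pencil N%:R s u (coordn c) (coordn c) = 0.
Proof.
have e k (lk : (k < 5)%N) : coordn c k = c (Ordinal lk).
  by congr c; apply/val_inj; rewrite /= inordK.
case; rewrite /= (mmap_quad1 f) (mmap_quad2 f) => q1 q2 s u.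
transitivity (s * (c i0 ^+ 2 + c i1 ^+ 2 + 3%:R * N%:R * (c i2 ^+ 2 + 2%:R * c i3 ^+ 2))
  + u * (2%:R * c i4 ^+ 2 - c i0 ^+ 2 - 2%:R * c i0 * c i1
         - 6%:R * N%:R * (c i2 ^+ 2 + 2%:R * c i2 * c i3 + 2%:R * c i3 ^+ 2))); last first.
  by rewrite q1 q2 !mulr0 addr0.
rewrite /pencil (e 0%N isT) (e 1%N isT) (e 2%N isT) (e 3%N isT) (e 4%N isT) -/i0 -/i1 -/i2 -/i3 -/i4.
by move: (c i0) (c i1) (c i2) (c i3) (c i4) => c0 c1 c2 c3 c4; ring.
Qed.

(* Over [L = Q(w)] write the point as [a + b w]: in the pencil some rational member vanishes at [b],
   and then the two remaining conditions say that it vanishes on the whole plane spanned by [a], [b]. *)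
Lemma surface_no_degree2 (N : nat) : (0 < N)%N ->
  (forall p, prime p -> (p %| N)%N -> (p %% 3 = 1)%N) ->
  ~ exists P : closed_point (surface N), cp_degree P = 2%N.
Proof.
move=> N0 Np [P]; rewrite /cp_degree; case: P => L c exj onX gen /= dL.
case: exj onX gen => j cj onX gen.
have [k ck] : exists k, c k \notin 1%VS.
  apply/existsP; apply: contraT; rewrite negb_exists => /forallP h.
  have : (<<1 & [seq c i | i : 'I_5]>> <= (1%AS : {subfield L}))%VS.
    apply/Fadjoin_seqP; split=> // _ /mapP[i _ ->].
    by have := h i; rewrite negbK.
  by rewrite gen => /dimvS; rewrite dL dimv1.
have [sp fr] := quadratic_extension_coord dL ck.
have [n [t ew]] := sp (c k ^+ 2).
have /fin_all_exists[ab abE] (i : 'I_5) : exists ab : rat * rat,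
    c i = in_alg L ab.1 + in_alg L ab.2 * c k.
  by have [a [b e]] := sp (c i); exists (a, b).
pose a := coordn (fun i => (ab i).1); pose b := coordn (fun i => (ab i).2).
have key s u : pencil N%:R s u a a + n * pencil N%:R s u b b = 0
    /\ 2%:R * pencil N%:R s u a b + t * pencil N%:R s u b b = 0.
  apply: fr; have := on_surface_pencil (f := in_alg L) onX (in_alg L s) (in_alg L u).
  rewrite (_ : pencil _ _ _ _ _ = pencil N%:R (in_alg L s) (in_alg L u)
    (fun l => in_alg L (a l) + in_alg L (b l) * c k)
    (fun l => in_alg L (a l) + in_alg L (b l) * c k)); last first.
    rewrite -[RHS]mul1r -[1]mul1r; symmetry; apply: pencilZ => l _; rewrite mul1r; exact/esym/abE.
  have ew' : c k ^+ 2 = in_alg L t * c k + in_alg L n by rewrite ew addrC.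
  by rewrite (rmorph_pencil_extension N s u a b ew').
have [s [u [su bb]]] : exists s u : rat, (s != 0) || (u != 0) /\ pencil N%:R s u b b = 0.
  have [z | nz] := eqVneq (pencil N%:R 1 0 b b) 0; first by exists 1, 0.
  exists (pencil N%:R 0 1 b b), (- pencil N%:R 1 0 b b); rewrite oppr_eq0 nz orbT; split=> //.
  by rewrite pencil_member; ring.
have [] := key s u; rewrite bb !mulr0 !addr0 => aa /eqP.
rewrite mulf_eq0 pnatr_eq0 /= => /eqP ab0.
apply: (no_rational_plane N0 Np su (_ : isotropic _ a b)); first by [].
have cE i (x y : rat) : c i = in_alg L x + in_alg L y * c k -> ab i = (x, y).
  move=> e; have [] := fr ((ab i).1 - x) ((ab i).2 - y).
    by rewrite (rmorphB (in_alg L)) (rmorphB (in_alg L) _ y) mulrBl addrACA -opprD -abE -e subrr.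
  by move=> /eqP + /eqP; rewrite !subr_eq0 => /eqP + /eqP; case: (ab i) => ? ? /= -> ->.
(* The coordinates c_k = w and c_j = 1 have components (0, 1) and (1, 0), so the minor (k, j) of [a]
   and [b] is -1. *)
exists k, j; split=> //; rewrite /minor /a /b /coordn !inord_val.
have -> : ab k = (0, 1) by apply: cE; rewrite rmorph0 rmorph1 add0r mul1r.
have -> : ab j = (1, 0) by apply: cE; rewrite rmorph0 rmorph1 mul0r addr0.
by [].
Qed.

(** * Fields of small degree and the closed points they provide *)

Lemma dim_adjoin_sqrt (L : fieldExtType rat) (K : {subfield L}) (x : L) :
  x ^+ 2 \in K -> (\dim <<K; x>> %| 2 * \dim K)%N.
Proof.
move=> xK; rewrite dim_Fadjoin dvdn_pmul2r ?adim_gt0 //.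
have dv : minPoly K x %| 'X^2 - (x ^+ 2)%:P.
  apply: minPoly_dvdp; first by rewrite rpredB ?rpredX ?polyOverX ?polyOverC.
  by rewrite /root !hornerE subrr.
have sz : size ('X^2 - (x ^+ 2)%:P : {poly L}) = 3%N by rewrite size_XnsubC.
have nz : 'X^2 - (x ^+ 2)%:P != 0 :> {poly L} by rewrite -size_poly_eq0 sz.
have := dvdp_leq nz dv; rewrite size_minPoly sz ltnS.
have : (0 < adjoin_degree K x)%N by [].
by case: (adjoin_degree K x) => [|[|[|n]]].
Qed.

Lemma F2_cubic (x y : 'F_2) : x ^+ 3 + x * y ^+ 2 + y ^+ 3 = 0 -> x = 0 /\ y = 0.
Proof.
case: x => [[|[|//]] lx]; case: y => [[|[|//]] ly] => /(congr1 (@nat_of_ord _)) // _.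
by split; apply/val_inj.
Qed.

Lemma cubic_no_rat_root (r : rat) : r ^+ 3 + r + 1 != 0.
Proof.
apply/eqP => e; set a := numq r; set d := denq r.
have d0 : d%:~R != 0 :> rat by rewrite intr_eq0 denq_neq0.
have rE : r * d%:~R = a%:~R by rewrite /a numqE.
have ei : a ^+ 3 + a * d ^+ 2 + d ^+ 3 = 0.
  apply: (@intr_inj rat); rewrite !(rmorphD, rmorphM, rmorphXn) /= -rE rmorph0.
  transitivity ((r ^+ 3 + r + 1) * d%:~R ^+ 3); first by ring.
  by rewrite e mul0r.
pose phi (x : int) : 'F_2 := x%:~R.
have phi0 x : (phi x == 0) = (2 %| x)%Z := @Fp_intr_eq0 2 x isT.
have [/eqP a0 /eqP dd0] : phi a = 0 /\ phi d = 0.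
  apply: F2_cubic; transitivity (phi (a ^+ 3 + a * d ^+ 2 + d ^+ 3)); last by rewrite ei.
  by rewrite /phi; ring.
have := coprime_num_den r; rewrite -/a -/d => co.
have : (2 %| gcdn `|a| `|d|)%N.
  by rewrite dvdn_gcd; move: a0 dd0; rewrite !phi0 !dvdzE => -> ->.
by rewrite (eqP co).
Qed.

(** Only degree 2 needs an argument: the cofactor of the minimal polynomial in the cubic would be
    linear and give a rational root. *)
Lemma dim_adjoin_cubic (L : fieldExtType rat) (k : L) :
  k ^+ 3 + k + 1 = 0 -> (\dim <<1; k>> %| 3)%N.
Proof.
move=> ek; rewrite (dim_Fadjoin 1%AS) dimv1 muln1.
have [m mE] := polyOver1P (minPolyOver 1%AS k).
have sm : size m = (adjoin_degree 1%AS k).+1 by rewrite -size_minPoly mE size_map_poly.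
pose p : {poly rat} := 'X^3 + ('X + 1%:P).
have sp1 : size ('X + 1%:P : {poly rat}) = 2%N by rewrite size_XaddC.
have sp : size p = 4%N by rewrite size_polyDl size_polyXn ?sp1.
have p0 : p != 0 by rewrite -size_poly_eq0 sp.
have : m %| p.
  rewrite -(dvdp_map (in_alg L)) -mE; apply: minPoly_dvdp; first exact: alg_polyOver.
  apply/rootP; rewrite /p !rmorphD /= map_polyXn map_polyX map_polyC /= !hornerE.
  by rewrite scale1r; exact: ek.
case/dvdpP => q pE.
have q0 : q != 0 by apply: contraNneq p0 => q0; rewrite pE q0 mul0r.
have m0 : m != 0 by apply: contraNneq p0 => m0; rewrite pE m0 mulr0.
have := sp; rewrite pE size_mul // sm addnS /=.
have : (0 < adjoin_degree 1%AS k)%N by [].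
have : (0 < size q)%N by rewrite size_poly_gt0.
case: (adjoin_degree 1%AS k) => [|[|[|[|n]]]] //; last by case: (size q) => [|s] // _ _; rewrite addnS => -[]; lia.
move=> _ _ sq; have sq2 : size q = 2%N by apply/eqP; rewrite -(eqn_add2r 2) sq.
have [r rq] := poly2_root sq2.
have pr : p.[r] = 0 by rewrite pE hornerM (rootP rq) mul0r.
have pE' : p.[r] = r ^+ 3 + r + 1 by rewrite /p !hornerE ?addrA.
by have := cubic_no_rat_root r; rewrite -pE' pr eqxx.
Qed.

(** The residue field is generated by the ratios c_i / c_j and may be smaller than L, hence
    divisibility instead of equality of degrees. *)
Lemma closed_point_of_field N (L : fieldExtType rat) (c : 'I_5 -> L) :
  on_forms (in_alg L) (X := surface N) c -> (exists j, c j != 0) ->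
  exists P : closed_point (surface N), (cp_degree P %| \dim {: L})%N.
Proof.
case; rewrite /= (mmap_quad1 (in_alg L)) (mmap_quad2 (in_alg L)) => q1 q2 [j cj].
pose c' i := c i / c j.
pose E : {subfield L} := <<1 & [seq c' i | i : 'I_5]>>%AS.
have cE i : c' i \in E.
  have /Fadjoin_seqP[_ h] : (<<1 & [seq c' i | i : 'I_5]>> <= E)%VS by [].
  by apply: h; apply: map_f; rewrite mem_enum.
pose d i : subvs_of E := vsproj E (c' i).
have dE i : vsval (d i) = c' i by rewrite /d vsprojK.
have dj : d j = 1 by apply/val_inj; rewrite /= dE /c' divff // algid1.
have on : on_forms (in_alg (subvs_of E)) (X := surface N) d.
  split; rewrite /= ?(mmap_quad1 (in_alg (subvs_of E))) ?(mmap_quad2 (in_alg (subvs_of E)));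
    apply: (fmorph_inj (vsval : {rmorphism subvs_of E -> L})); rewrite rmorph0.
    pose f : {rmorphism subvs_of E -> L} := vsval.
    rewrite -[LHS]/(f _) !(rmorph_nat f, rmorphXn f, rmorphD f, rmorphM f) /f /= !dE /c'.
    by apply: (mulfI (expf_neq0 2 cj)); rewrite mulr0 -[RHS]q1; field.
  pose f : {rmorphism subvs_of E -> L} := vsval.
  rewrite -[LHS]/(f _) !(rmorph_nat f, rmorphXn f, rmorphN f, rmorphD f, rmorphM f) /f /= !dE /c'.
  by apply: (mulfI (expf_neq0 2 cj)); rewrite mulr0 -[RHS]q2; field.
have dim_subvs : \dim {: subvs_of E} = \dim E by rewrite dimvf.
have gen : <<1 & [seq d i | i : 'I_5]>>%VS = {: subvs_of E}%VS.
  pose f : 'AHom(subvs_of E, L) := linfun_ahom (vsval : {lrmorphism subvs_of E -> L}).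
  have e : (f @: <<1 & [seq d i | i : 'I_5]>> = E)%VS.
    rewrite aimg_adjoin_seq aimg1 -map_comp; congr <<1 & _>>%VS.
    by apply: eq_map => i; rewrite /= lfunE /= dE.
  have ed : \dim (f @: <<1 & [seq d i | i : 'I_5]>>)%VS = \dim <<1 & [seq d i | i : 'I_5]>>%VS.
    by apply: limg_dim_eq; rewrite (eqP (AHom_lker0 f)) capv0.
  by apply/eqP; rewrite eqEdim subvf dim_subvs -ed e leqnn.
exists (@ClosedPoint (surface N) (subvs_of E) d (ex_intro _ j dj) on gen).
by rewrite /cp_degree /= dim_subvs; apply: field_dimS; apply: subvf.
Qed.

Lemma on_surface_of_pencil (L : comNzRingType) (f : {rmorphism rat -> L}) N (p : nat -> L) :
  pencil N%:R 1 0 p p = 0 -> pencil N%:R 0 1 p p = 0 ->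
  on_forms f (X := surface N) (fun i : 'I_5 => p i).
Proof.
rewrite /pencil => p1 p2; split; rewrite /= ?(mmap_quad1 f) ?(mmap_quad2 f).
  by rewrite -[RHS]p1 /=; ring.
by rewrite -[RHS]p2 /=; ring.
Qed.

Definition tuple5 (R : Type) (x y z v w : R) (i : nat) : R :=
  match i with 0 => x | 1 => y | 2 => z | 3 => v | _ => w end.

Lemma surface_point_quartic N : exists P : closed_point (surface N), (cp_degree P %| 4)%N.
Proof.
have [L [f [s sE gen]]] := num_field_exists [:: sqrtC (- (3 * N)%:R); sqrtC ((3 * N)%:R / 2%:R)].
case: s sE gen => [|x [|w [|]]] //= [ex ew] gen.
have x2 : x ^+ 2 = - (3 * N)%:R.
  by apply: (fmorph_inj f); rewrite rmorphXn /= ex sqrtCK rmorphN rmorph_nat.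
have w2 : 2%:R * w ^+ 2 = (3 * N)%:R.
  apply: (fmorph_inj f); rewrite rmorphM rmorphXn /= ew sqrtCK !rmorph_nat.
  by rewrite mulrC divfK // pnatr_eq0.
have on : on_forms (in_alg L) (X := surface N) (fun i : 'I_5 => tuple5 x 0 1 0 w i).
  apply: on_surface_of_pencil; rewrite /pencil /=.
    rewrite (_ : _ + _ = x ^+ 2 + (3 * N)%:R); last by rewrite natrM; ring.
    by rewrite x2 addNr.
  rewrite (_ : _ + _ = 2%:R * w ^+ 2 - x ^+ 2 - 2%:R * (3 * N)%:R); last by rewrite natrM; ring.
  by rewrite w2 x2; ring.
have [|P hP] := closed_point_of_field on; first by exists i2; rewrite /= oner_eq0.
exists P; apply: dvdn_trans hP _; rewrite -gen adjoin_cons adjoin_seq1.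
have h1 : (\dim <<1; x>> %| 2)%N.
  have := @dim_adjoin_sqrt L 1%AS x; rewrite dimv1 muln1; apply.
  by rewrite x2 rpredN rpred_nat.
apply: dvdn_trans (@dim_adjoin_sqrt L <<1; x>>%AS w _) _.
  have -> : w ^+ 2 = (3 * N)%:R / 2%:R.
    by rewrite -w2 mulrC mulKf // -(rmorph_nat (in_alg L)) fmorph_eq0 pnatr_eq0.
  by rewrite rpred_div ?rpred_nat.
by rewrite -[4%N]/(2 * 2)%N dvdn_pmul2l.
Qed.

(** * A line on a cubic member of the pencil *)

Section TwistedPlane.

Variables (R : comPzRingType) (N c U V k : R).

Let sg := k - 1.
Let g := k ^+ 2 - 2%:R * k - 1.

(* The (z, v)-block of the member (s : u) = (1 + k : 1) is, up to the factor [k - 1], the norm form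
   [ze^2 + 2 g v^2]; multiplication by the norm [U^2 + 2 g V^2 = N c^2] absorbs the factor N. *)
Definition twist (x y z v w : R) : nat -> R :=
  let ze := sg * z - 2%:R * v in
  let z1 := ze * U + 2%:R * g * v * V in
  let v1 := v * U - ze * V in
  tuple5 (sg * N * c * x) (sg * N * c * y) (z1 + 2%:R * v1) (sg * v1) (sg * N * c * w).

Lemma pencil_twist x y z v w x' y' z' v' w' : N * c ^+ 2 = U ^+ 2 + 2%:R * g * V ^+ 2 ->
  pencil N (1 + k) 1 (twist x y z v w) (twist x' y' z' v' w')
  = (sg * N * c) ^+ 2 * pencil 1 (1 + k) 1 (tuple5 x y z v w) (tuple5 x' y' z' v' w').
Proof.
move=> h; pose C := sg * (z * z' + 2%:R * (v * v')) - 2%:R * (z * v' + v * z').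
pose m := sg * N * c.
pose B0 := (1 + k) * (x * x' + y * y') + (2%:R * (w * w') - x * x' - (x * y' + y * x')).
transitivity (m ^+ 2 * B0 + 3%:R * N * (sg ^+ 2 * (U ^+ 2 + 2%:R * g * V ^+ 2) * C)).
  by rewrite /pencil /twist /m /B0 /C /g /sg /=; ring.
by rewrite -h /pencil /m /B0 /C /sg /=; ring.
Qed.

(** Before the twist both spanning vectors satisfy y = kx and w = (1 - k - k^2) v, with 1 - k - k^2
    = -F(1 + k, 1). *)
Definition plane_a := twist (1 + k) (k + k ^+ 2) (- 2%:R - k) 1 (1 - k - k ^+ 2).
Definition plane_b := twist (- 1) (- k) (- 1 - k - k ^+ 2) 1 (1 - k - k ^+ 2).

Lemma plane_isotropic : k ^+ 3 + k + 1 = 0 -> N * c ^+ 2 = U ^+ 2 + 2%:R * g * V ^+ 2 ->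
  isotropic (pencil N (1 + k) 1) plane_a plane_b.
Proof.
move=> ek h; split; rewrite pencil_twist //.
- transitivity ((sg * N * c) ^+ 2 * ((k ^+ 3 + k + 1) * (8%:R + 5%:R * k + k ^+ 2))).
    by congr (_ * _); rewrite /pencil /=; ring.
  by rewrite ek mul0r mulr0.
- transitivity ((sg * N * c) ^+ 2 * ((k ^+ 3 + k + 1) * (8%:R + 4%:R * k))).
    by congr (_ * _); rewrite /pencil /=; ring.
  by rewrite ek mul0r mulr0.
- transitivity ((sg * N * c) ^+ 2 * ((k ^+ 3 + k + 1) * (5%:R + 5%:R * k + 3%:R * k ^+ 2))).
    by congr (_ * _); rewrite /pencil /=; ring.
  by rewrite ek mul0r mulr0.
Qed.

(** Minus the Gram determinant of Q1 on the plane: a square root of it defines the two zeros of Q1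
    on the corresponding projective line. *)
Definition plane_disc : R :=
  pencil N 1 0 plane_a plane_b ^+ 2 - pencil N 1 0 plane_a plane_a * pencil N 1 0 plane_b plane_b.

End TwistedPlane.

Lemma rmorph_twist (R S : comPzRingType) (f : {rmorphism R -> S}) (N c U V k x y z v w : R) i :
  f (twist N c U V k x y z v w i)
  = twist (f N) (f c) (f U) (f V) (f k) (f x) (f y) (f z) (f v) (f w) i.
Proof.
case: i => [|[|[|[|i]]]] /=;
  by rewrite !(rmorph1 f, rmorph_nat f, rmorphXn f, rmorphN f, rmorphD f, rmorphM f).
Qed.

Lemma rmorph_plane_disc (R S : comPzRingType) (f : {rmorphism R -> S}) (N c U V k : R) :
  f (plane_disc N c U V k) = plane_disc (f N) (f c) (f U) (f V) (f k).
Proof.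
have pE x x' y y' : (forall i, f (x i) = y i) -> (forall i, f (x' i) = y' i) ->
    f (pencil N 1 0 x x') = pencil (f N) 1 0 y y'.
  by move=> h h'; rewrite (rmorph_pencil f) rmorph1 rmorph0 /pencil /= !h !h'.
have aE i : f (plane_a N c U V k i) = plane_a (f N) (f c) (f U) (f V) (f k) i.
  rewrite /plane_a rmorph_twist; congr (twist _ _ _ _ _ _ _ _ _ _ i);
  by rewrite !(rmorph1 f, rmorph_nat f, rmorphXn f, rmorphN f, rmorphD f).
have bE i : f (plane_b N c U V k i) = plane_b (f N) (f c) (f U) (f V) (f k) i.
  rewrite /plane_b rmorph_twist; congr (twist _ _ _ _ _ _ _ _ _ _ i);
  by rewrite !(rmorph1 f, rmorph_nat f, rmorphXn f, rmorphN f, rmorphD f).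
rewrite /plane_disc (rmorphB f) (rmorphXn f) (rmorphM f).
by rewrite (pE _ _ _ _ aE bE) (pE _ _ _ _ aE aE) (pE _ _ _ _ bE bE).
Qed.

(** On the plane (1 + k) Q1 + Q2 is zero, so a zero of Q1 is also one of Q2; solving the binary form
    Q1 requires only [th]. The rest of the proof shows that the vector found is nonzero. *)
Lemma plane_point (F : fieldType) (N c U V k th : F) (g := k ^+ 2 - 2%:R * k - 1) :
  3%:R != 0 :> F -> N != 0 -> c != 0 -> k ^+ 3 + k + 1 = 0 ->
  N * c ^+ 2 = U ^+ 2 + 2%:R * g * V ^+ 2 -> th ^+ 2 = plane_disc N c U V k ->
  exists p : nat -> F, [/\ pencil N 1 0 p p = 0, pencil N 0 1 p p = 0 & (p 0%N != 0) || (p 4%N != 0)].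
Proof.
move=> n3 N0 c0 ek h eth.
have [aa ab bb] := plane_isotropic ek h.
set a := plane_a _ _ _ _ _ in aa ab; set b := plane_b _ _ _ _ _ in ab bb.
(* For k of degree 3 the norms of k - 1, 1 - k - k^2 and 2 + k are 3, 9, 9 up to sign, so none of
   them vanishes where 3 is invertible. *)
have sg0 : k - 1 != 0.
  apply: contraNneq n3 => k1; rewrite -[_ == 0]/(3%:R == 0) -ek.
  rewrite (_ : k ^+ 3 + k + 1 = (k - 1) * (k ^+ 2 + k + 2%:R) + 3%:R); last by ring.
  by rewrite k1 mul0r add0r.
have W0 : 1 - k - k ^+ 2 != 0.
  apply/eqP => W; have := oner_neq0 F; case/eqP.
  have k3 : 3%:R * k = 0.
    rewrite -[RHS]ek (_ : k ^+ 3 + k + 1 = 3%:R * k + (1 - k) * (1 - k - k ^+ 2)); last by ring.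
    by rewrite W mulr0 addr0.
  have /eqP : 3%:R * k = 0 := k3; rewrite mulf_eq0 (negbTE n3) /= => /eqP k0.
  by rewrite -[RHS]ek k0; ring.
have k2 : 2%:R + k != 0.
  apply: contraNneq n3 => k2; rewrite -[X in X == 0]mul1r.
  have : 3%:R * 3%:R = 0 :> F.
    rewrite (_ : 3%:R * 3%:R = (2%:R + k) * (k ^+ 2 - 2%:R * k + 5%:R) - (k ^+ 3 + k + 1)); last by ring.
    by rewrite k2 ek mul0r subr0.
  by move/eqP; rewrite mulf_eq0 mul1r orbb.
pose m := (k - 1) * N * c; have m0 : m != 0 by rewrite !mulf_neq0.
have lin l u : pencil N 1 0 (fun i => l * a i + u * b i) (fun i => l * a i + u * b i) = 0 ->
    pencil N 0 1 (fun i => l * a i + u * b i) (fun i => l * a i + u * b i) = 0.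
  move=> e1; have : pencil N (1 + k) 1 (fun i => l * a i + u * b i) (fun i => l * a i + u * b i) = 0.
    by rewrite pencil_combination aa ab bb; ring.
  by rewrite pencil_member e1 mulr0 add0r mul1r.
pose al := pencil N 1 0 a a; pose be := pencil N 1 0 a b; pose ga := pencil N 1 0 b b.
have eth' : th ^+ 2 = be ^+ 2 - al * ga by [].
have [al0 | al0] := eqVneq al 0.
  exists (fun i => 1 * a i + 0 * b i).
  have e1 : pencil N 1 0 (fun i => 1 * a i + 0 * b i) (fun i => 1 * a i + 0 * b i) = 0.
    by rewrite pencil_combination -/al al0; ring.
  split=> //; first exact: lin.
  apply/orP; right; rewrite mul1r mul0r addr0 /a /plane_a /twist /= -/m.
  by rewrite mulf_neq0.
pose l := th - be.
have e1 : pencil N 1 0 (fun i => l * a i + al * b i) (fun i => l * a i + al * b i) = 0.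
  rewrite pencil_combination -/al -/be -/ga.
  transitivity (al * (th ^+ 2 - (be ^+ 2 - al * ga))); first by rewrite /l; ring.
  by rewrite eth' subrr mulr0.
exists (fun i => l * a i + al * b i); split=> //; first exact: lin.
(* The w-entries of [a] and [b] coincide, so w = 0 gives l = -al; their x-entries differ by m(2 +
   k), so x = 0 then gives al = 0. *)
rewrite /a /b /plane_a /plane_b /twist /= -/m; apply: contraNT al0.
rewrite negb_or !negbK => /andP[/eqP ex /eqP ew].
have lal : l + al = 0.
  apply: (mulIf (mulf_neq0 m0 W0)); rewrite mul0r -[RHS]ew; ring.
have : al * (m * (2%:R + k)) = 0.
  rewrite (_ : al * (m * (2%:R + k)) = (l + al) * (m * (1 + k)) -
    (l * (m * (1 + k)) + al * (m * - 1))); last by ring.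
  by rewrite lal ex; ring.
by move/eqP; rewrite mulf_eq0 (negbTE (mulf_neq0 m0 k2)) orbF.
Qed.

(** * A polynomial family of simultaneous norms *)

(* With r^2 = -2, w^2 + w + 1 = 0 and p a root of X^4 - 6X^3 + 10X^2 - 2 (which splits into two
   conjugate quadratic factors over Q(k, sqrt g)), these are the components of the partial norms of
   b p^2 + b r w p + r; the full norm [norm_value] is thus a norm from several subfields at once. *)
Section NormFamily.

Variables (R : comPzRingType) (b k : R).

Definition normS0 : R := 1%:R - 3%:R * b - 61%:R * b ^+ 2 + 23%:R * b ^+ 2 * k - 34%:R * b ^+ 2 * k ^+ 2 + 201%:R * b ^+ 3 - 78%:R * b ^+ 3 * k + 138%:R * b ^+ 3 * k ^+ 2 + 292%:R * b ^+ 4 - 139%:R * b ^+ 4 * k + 200%:R * b ^+ 4 * k ^+ 2.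
Definition normS1 : R := - 8%:R * b + 27%:R * b ^+ 2 - 6%:R * b ^+ 2 * k + 12%:R * b ^+ 2 * k ^+ 2 + 134%:R * b ^+ 3 - 65%:R * b ^+ 3 * k + 91%:R * b ^+ 3 * k ^+ 2 - 297%:R * b ^+ 4 + 138%:R * b ^+ 4 * k - 204%:R * b ^+ 4 * k ^+ 2.
Definition normT0 : R := 2%:R * b - 1%:R * b * k + 1%:R * b * k ^+ 2 + 69%:R * b ^+ 2 - 26%:R * b ^+ 2 * k + 32%:R * b ^+ 2 * k ^+ 2 - 214%:R * b ^+ 3 + 101%:R * b ^+ 3 * k - 143%:R * b ^+ 3 * k ^+ 2 - 321%:R * b ^+ 4 + 150%:R * b ^+ 4 * k - 222%:R * b ^+ 4 * k ^+ 2.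
Definition normT1 : R := 6%:R * b - 2%:R * b * k + 2%:R * b * k ^+ 2 - 26%:R * b ^+ 2 + 12%:R * b ^+ 2 * k - 13%:R * b ^+ 2 * k ^+ 2 - 150%:R * b ^+ 3 + 67%:R * b ^+ 3 * k - 100%:R * b ^+ 3 * k ^+ 2 + 326%:R * b ^+ 4 - 152%:R * b ^+ 4 * k + 223%:R * b ^+ 4 * k ^+ 2.
Definition nu0 : R := 1%:R - 6%:R * b - 198%:R * b ^+ 2 + 726%:R * b ^+ 3 + 1246%:R * b ^+ 4 - 942%:R * b ^+ 5 + 150%:R * b ^+ 6 - 18%:R * b ^+ 7 + 45%:R * b ^+ 8.
Definition nu1 : R := - 16%:R * b + 78%:R * b ^+ 2 + 512%:R * b ^+ 3 - 1308%:R * b ^+ 4 - 240%:R * b ^+ 5 - 78%:R * b ^+ 6 - 36%:R * b ^+ 7 - 36%:R * b ^+ 8.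
Definition normA : R := 1%:R - 24%:R * b ^+ 2 + 120%:R * b ^+ 3 + 1214%:R * b ^+ 4 + 72%:R * b ^+ 5 + 840%:R * b ^+ 6 - 96%:R * b ^+ 7 + 9%:R * b ^+ 8.
Definition normB : R := 12%:R * b - 56%:R * b ^+ 2 + 348%:R * b ^+ 3 - 676%:R * b ^+ 4 + 564%:R * b ^+ 5 + 480%:R * b ^+ 6 - 12%:R * b ^+ 7 + 72%:R * b ^+ 8.
Definition norm_value : R := nu0 ^+ 2 + 2%:R * nu1 ^+ 2.

Let g := k ^+ 2 - 2%:R * k - 1.

(** Put S = S0 + r S1, T = T0 + r T1, and S', T' for their conjugates under r -> -r. Then U + r V
    sqrt g = (S + T sqrt g)(S' - T' sqrt g), which has norm U^2 + 2g V^2. *)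
Definition normU : R := normS0 ^+ 2 + 2%:R * normS1 ^+ 2 - g * (normT0 ^+ 2 + 2%:R * normT1 ^+ 2).
Definition normV : R := 2%:R * (normT1 * normS0 - normT0 * normS1).

(** With S and T as for [normU], nu0 + r nu1 is the norm S^2 - g T^2 from Q(k, r, sqrt g) to Q(k,
    r). That it does not involve k holds only modulo the cubic, hence the explicit cofactor. *)
Lemma nu0E : k ^+ 3 + k + 1 = 0 ->
  nu0 = normS0 ^+ 2 - 2%:R * normS1 ^+ 2 - g * (normT0 ^+ 2 - 2%:R * normT1 ^+ 2).
Proof.
move=> ek; apply/eqP; rewrite -subr_eq0; apply/eqP.
transitivity (- (k ^+ 3 + k + 1) * (- 111%:R * b ^+ 2 + 65%:R * b ^+ 2 * k - 28%:R * b ^+ 2 * k ^+ 2 + 7%:R * b ^+ 2 * k ^+ 3 + 1806%:R * b ^+ 3 - 1230%:R * b ^+ 3 * k + 652%:R * b ^+ 3 * k ^+ 2 - 168%:R * b ^+ 3 * k ^+ 3 + 10836%:R * b ^+ 4 - 6894%:R * b ^+ 4 * k + 4288%:R * b ^+ 4 * k ^+ 2 - 1200%:R * b ^+ 4 * k ^+ 3 - 103548%:R * b ^+ 5 + 76048%:R * b ^+ 5 * k - 59088%:R * b ^+ 5 * k ^+ 2 + 16580%:R * b ^+ 5 * k ^+ 3 - 8807%:R * b ^+ 6 + 4361%:R * b ^+ 6 * k - 4776%:R * b ^+ 6 * k ^+ 2 + 2163%:R * b ^+ 6 * k ^+ 3 + 609582%:R * b ^+ 7 - 503834%:R * b ^+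 7 * k + 513692%:R * b ^+ 7 * k ^+ 2 - 152692%:R * b ^+ 7 * k ^+ 3 - 200710%:R * b ^+ 8 + 166364%:R * b ^+ 8 * k - 169332%:R * b ^+ 8 * k ^+ 2 + 50174%:R * b ^+ 8 * k ^+ 3)); last by rewrite ek oppr0 mul0r.
by rewrite /nu0 /normS0 /normS1 /normT0 /normT1 /g; ring.
Qed.

Lemma nu1E : k ^+ 3 + k + 1 = 0 ->
  nu1 = 2%:R * (normS0 * normS1 - g * (normT0 * normT1)).
Proof.
move=> ek; apply/eqP; rewrite -subr_eq0; apply/eqP.
transitivity (- (k ^+ 3 + k + 1) * (48%:R * b ^+ 2 - 32%:R * b ^+ 2 * k + 16%:R * b ^+ 2 * k ^+ 2 - 4%:R * b ^+ 2 * k ^+ 3 + 1294%:R * b ^+ 3 - 796%:R * b ^+ 3 * k + 386%:R * b ^+ 3 * k ^+ 2 - 102%:R * b ^+ 3 * k ^+ 3 - 13356%:R * b ^+ 4 + 9376%:R * b ^+ 4 * k - 5962%:R * b ^+ 4 * k ^+ 2 + 1604%:R * b ^+ 4 * k ^+ 3 - 20264%:R * b ^+ 5 + 13372%:R * b ^+ 5 * k - 10416%:R * b ^+ 5 * k ^+ 2 + 3124%:R * b ^+ 5 * k ^+ 3 + 231828%:R * b ^+ 6 - 181018%:R * b ^+ 6 * k + 167202%:R * b ^+ 6 * k ^+ 2 - 48644%:R * b ^+ 6 * k ^+ 3 - 84330%:R * b ^+ 7 + 67364%:R * b ^+ 7 * k - 67526%:R * b ^+ 7 * k ^+ 2 +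 19378%:R * b ^+ 7 * k ^+ 3 - 382704%:R * b ^+ 8 + 322662%:R * b ^+ 8 * k - 332412%:R * b ^+ 8 * k ^+ 2 + 99012%:R * b ^+ 8 * k ^+ 3)); last by rewrite ek oppr0 mul0r.
by rewrite /nu1 /normS0 /normS1 /normT0 /normT1 /g; ring.
Qed.

Lemma norm_valueE : k ^+ 3 + k + 1 = 0 -> norm_value = normU ^+ 2 + 2%:R * g * normV ^+ 2.
Proof. by move=> ek; rewrite /norm_value /normU /normV nu0E // nu1E //; ring. Qed.

Lemma norm_value_Eisenstein : norm_value = normA ^+ 2 - normA * normB + normB ^+ 2.
Proof. by rewrite /norm_value /nu0 /nu1 /normA /normB; ring. Qed.

(** Serves twice: a prime dividing b does not divide the value, and modulo such a prime the value is
    the square 1. *)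
Lemma norm_value_mod : exists r, norm_value = 1 + b * r.
Proof.
pose P0 := - 6%:R - 198%:R * b + 726%:R * b ^+ 2 + 1246%:R * b ^+ 3 - 942%:R * b ^+ 4 + 150%:R * b ^+ 5 - 18%:R * b ^+ 6 + 45%:R * b ^+ 7; pose P1 := - 16%:R + 78%:R * b + 512%:R * b ^+ 2 - 1308%:R * b ^+ 3 - 240%:R * b ^+ 4 - 78%:R * b ^+ 5 - 36%:R * b ^+ 6 - 36%:R * b ^+ 7.
exists (2%:R * P0 + b * P0 ^+ 2 + 2%:R * b * P1 ^+ 2).
by rewrite /norm_value /nu0 /nu1 /P0 /P1; ring.
Qed.

End NormFamily.

(** Both nu0(1) = 1004 and nu1(1) = -1124 are 4 mod 8, so the same holds at every b = 1 mod 8; the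
    sum nu0^2 + 2 nu1^2 is then 16 times an odd square plus twice an odd square. *)
Lemma norm_value_mod16 (a : int) : exists m, norm_value (8%:R * a + 1) = 16%:R * (4%:R * m + 3%:R).
Proof.
pose b := 8%:R * a + 1.
(* 125 = (nu0(1) - 4)/8, and the bracket is the quotient of nu0(b) - nu0(1) by b - 1 = 8a; likewise
   -141 for nu1. *)
pose e0 := 125%:R + a * (1003%:R + 1009%:R * b + 1207%:R * b ^+ 2 + 481%:R * b ^+ 3 - 765%:R * b ^+ 4 + 177%:R * b ^+ 5 + 27%:R * b ^+ 6 + 45%:R * b ^+ 7).
pose e1 := - 141%:R + a * (- 1124%:R - 1108%:R * b - 1186%:R * b ^+ 2 - 1698%:R * b ^+ 3 - 390%:R * b ^+ 4 - 150%:R * b ^+ 5 - 72%:R * b ^+ 6 - 36%:R * b ^+ 7).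
have h0 : nu0 b = 4%:R + 8%:R * e0 by rewrite /nu0 /e0 /b; ring.
have h1 : nu1 b = 4%:R + 8%:R * e1 by rewrite /nu1 /e1 /b; ring.
exists (e0 + e0 ^+ 2 + 2%:R * e1 + 2%:R * e1 ^+ 2).
by rewrite /norm_value -/b h0 h1; ring.
Qed.

Section NormMorphism.

Variables (R S : comPzRingType) (f : {rmorphism R -> S}) (b k : R).

Let fE := (rmorph1 f, rmorph0 f, rmorph_nat f, rmorphXn f, rmorphN f, rmorphD f, rmorphM f).

Lemma rmorph_normU : f (normU b k) = normU (f b) (f k).
Proof. by rewrite /normU /normS0 /normS1 /normT0 /normT1 !fE. Qed.

Lemma rmorph_normV : f (normV b k) = normV (f b) (f k).
Proof. by rewrite /normV /normS0 /normS1 /normT0 /normT1 !fE. Qed.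

Lemma rmorph_norm_value : f (norm_value b) = norm_value (f b).
Proof. by rewrite /norm_value /nu0 /nu1 !fE. Qed.

End NormMorphism.

(** * Squarefree parts and quadratic residues at their primes *)

Lemma square_part (n : nat) : (0 < n)%N ->
  exists m c, [/\ n = (m * c ^ 2)%N, (0 < c)%N & forall p, prime p -> ~~ (p ^ 2 %| m)%N].
Proof.
elim/ltn_ind: n => n IH n0.
have [/existsP[[p lp] /= /andP[pp /dvdnP[k nk]]] | h] := boolP [exists p : 'I_n.+1, prime p && (p ^ 2 %| n)%N].
  have p1 := prime_gt1 pp.
  have k0 : (0 < k)%N by move: n0; rewrite nk muln_gt0 => /andP[].
  have kn : (k < n)%N by rewrite nk ltn_Pmulr // expnS expn1 (leq_trans p1) // leq_pmulr // prime_gt0.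
  have [m [c [ek c0 hm]]] := IH k kn k0.
  exists m, (c * p)%N; split=> //; first by rewrite nk ek expnMn mulnA.
  by rewrite muln_gt0 c0 prime_gt0.
exists n, 1%N; rewrite muln1; split=> // p pp; apply/negP => dv.
have lp : (p < n.+1)%N.
  by rewrite ltnS; apply: dvdn_leq => //; apply: dvdn_trans dv; rewrite expnS dvdn_mulr.
by case/existsP: h; exists (Ordinal lp); rewrite /= pp.
Qed.

(** The form x^2 + d y^2 takes a value of odd valuation at q. If q divides y, it divides x and c as
    well and all three can be divided by q; otherwise x/y is a square root of -d modulo q. *)
Lemma residue_of_form (q m : nat) (d : int) : prime q -> (q %| m)%N -> ~~ (q ^ 2 %| m)%N ->
  forall (c : nat) (x y : int), (0 < c)%N -> (m * c ^ 2)%N%:Z = x ^+ 2 + d * y ^+ 2 ->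
  exists t : int, (q %| t ^+ 2 + d)%Z.
Proof.
move=> pq /dvdnP[m1 mE] qm; elim/ltn_ind => c IH x y c0 e.
have q0 : q%:Z != 0 by rewrite eqz_nat -lt0n prime_gt0.
have qm1 : ~~ (q %| m1)%N.
  by apply: contra qm => /dvdnP[m2 m2E]; rewrite mE m2E -mulnA dvdn_mull.
have e' : m1%:Z * q%:Z * c%:Z ^+ 2 = x ^+ 2 + d * y ^+ 2 by rewrite -e mE; lia.
have [/dvdzP[y1 yE] | qy] := boolP (q %| y)%Z.
  have qx : (q %| x)%Z.
    have : (q %| x * x)%Z.
      apply/dvdzP; exists (m1%:Z * c%:Z ^+ 2 - d * y1 ^+ 2 * q%:Z).
      rewrite (_ : x * x = x ^+ 2 + d * y ^+ 2 - d * y ^+ 2); last by ring.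
      by rewrite -e' yE; ring.
    by rewrite dvdz_primeM // orbb.
  case/dvdzP: qx => x1 xE.
  have e2 : m1%:Z * c%:Z ^+ 2 = q%:Z * (x1 ^+ 2 + d * y1 ^+ 2).
    by apply: (mulfI q0); rewrite mulrCA mulrA e' xE yE; ring.
  have qc : (q %| c)%N.
    have : (q %| m1%:Z * (c%:Z * c%:Z))%Z by rewrite -expr2 e2 dvdz_mulr.
    rewrite dvdz_primeM // => /orP[h | ]; first by case/negP: qm1; exact: h.
    by rewrite dvdz_primeM // orbb.
  case/dvdnP: qc => c1 cE.
  have c10 : (0 < c1)%N by move: c0; rewrite cE muln_gt0 => /andP[].
  apply: (IH c1 _ x1 y1 c10); first by rewrite cE ltn_Pmulr // prime_gt1.
  apply: (mulfI q0); rewrite -e2 mE cE -mulnA PoszM; lia.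
have /coprimezP[[u v] /= uv] : coprimez y q%:Z.
  by rewrite coprimez_sym coprimezE absz_nat prime_coprime // -dvdzE.
exists (x * u); apply/dvdzP; exists (u ^+ 2 * m1%:Z * c%:Z ^+ 2 + d * v * (1 + u * y)).
have -> : (x * u) ^+ 2 + d = u ^+ 2 * (x ^+ 2 + d * y ^+ 2) + d * (1 - u * y) * (1 + u * y) by ring.
rewrite -e' (_ : 1 - u * y = v * q%:Z); last by rewrite -uv; ring.
by ring.
Qed.

Lemma prime_3mod4 (n : nat) : (n %% 4 = 3)%N -> exists q, [/\ prime q, (q %| n)%N & (q %% 4 = 3)%N].
Proof.
elim/ltn_ind: n => n IH n3.
have n1 : (1 < n)%N by case: n n3 {IH} => [|[|]].
have pp := pdiv_prime n1; have /dvdnP[k nk] := pdiv_dvd n.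
have [p3 | p3] := eqVneq (pdiv n %% 4)%N 3%N; first by exists (pdiv n); rewrite pdiv_dvd.
have k3 : (k %% 4 = 3)%N.
  have : ((k %% 4) * (pdiv n %% 4) %% 4 = 3)%N by rewrite modnMm -nk.
  move: p3 (ltn_pmod k (isT : 0 < 4)%N) (ltn_pmod (pdiv n) (isT : 0 < 4)%N).
  by move: (k %% 4)%N (pdiv n %% 4)%N => [|[|[|[|?]]]] [|[|[|[|?]]]].
have kn : (k < n)%N.
  have k0 : (0 < k)%N by case: (k) k3.
  by rewrite [X in (_ < X)%N]nk ltn_Pmulr // prime_gt1.
have [q [pq qk q3]] := IH k kn k3; exists q; split=> //.
by apply: dvdn_trans qk _; rewrite nk dvdn_mulr.
Qed.

Definition norm_squarefree (b : int) (N : nat) : Prop :=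
  exists c : nat, [/\ (0 < c)%N, (N * c ^ 2)%N%:Z = norm_value b,
    (N %% 4 = 3)%N & forall p, prime p -> ~~ (p ^ 2 %| N)%N].

(** Since 4 does not divide N, the factor 16 of the value goes into c^2; what remains is N c2^2 = 3
    mod 4, so N = 3 mod 4. *)
Lemma norm_squarefree_exists (a : int) : exists N, norm_squarefree (8%:R * a + 1) N.
Proof.
have [m em] := norm_value_mod16 a; set b := 8%:R * a + 1 in em *.
have nv0 : norm_value b >= 0.
  by apply: addr_ge0; [exact: sqr_ge0 | apply: mulr_ge0 => //; exact: sqr_ge0].
have nE : `|norm_value b|%N%:Z = norm_value b by rewrite gez0_abs.
have n0 : (0 < `|norm_value b|)%N by rewrite absz_gt0 em; apply/eqP; lia.
have [N [c [eN c0 sq]]] := square_part n0.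
have [m' em'] : exists m' : nat, (N * c ^ 2 = 16 * (4 * m' + 3))%N.
  have m0 : 0 <= m by move: nv0; rewrite em; lia.
  by exists `|m|%N; apply/eqP; rewrite -eqz_nat -eN nE em; apply/eqP; lia.
have sq2 : ~~ (4 %| N)%N := sq 2%N isT.
have even_c d M : (N * d ^ 2 = 4 * M)%N -> exists d', d = (2 * d')%N.
  move=> e; have [dodd | deven] := boolP (odd d); last by exists d./2; rewrite -[LHS]odd_double_half (negbTE deven) add0n mul2n.
  case/negP: sq2; have : (4 %| N * d ^ 2)%N by rewrite e dvdn_mulr.
  by rewrite Gauss_dvdl // -[4%N]/(2 ^ 2)%N coprimeXl // coprimeXr // coprime2n.
have [c1 ec1] : exists d', c = (2 * d')%N.
  by apply: (even_c c (4 * (4 * m' + 3))%N); rewrite em'; lia.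
have e1 : (N * c1 ^ 2 = 4 * (4 * m' + 3))%N by move: em'; rewrite ec1 expnMn; lia.
have [c2 ec2] := even_c c1 _ e1.
have e2 : (N * c2 ^ 2 = 4 * m' + 3)%N by move: e1; rewrite ec2 expnMn; lia.
exists N, c; split=> //; first by rewrite -eN nE.
have : ((N %% 4) * ((c2 %% 4) ^ 2) %% 4 = 3)%N.
  by rewrite -modnMm modn_mod modnXm modnMm e2 mulnC modnMDl.
move: (ltn_pmod N (isT : 0 < 4)%N) (ltn_pmod c2 (isT : 0 < 4)%N).
by move: (N %% 4)%N (c2 %% 4)%N => [|[|[|[|?]]]] [|[|[|[|?]]]].
Qed.

(** A base b divisible by 3 makes the value 1 mod 3, which excludes q = 3. As q divides the value to
    an odd power, its two representations as norms make -2 and -3 squares modulo q. *)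
Lemma norm_squarefree_prime (b : int) (N q : nat) : norm_squarefree b N -> (3 %| b)%Z ->
  prime q -> (q %| N)%N ->
  [/\ q != 2%N, q != 3%N, (q %% 3 = 1)%N, exists t : int, (q %| t ^+ 2 + 2%:R)%Z
    & exists t : int, (q %| t ^+ 2 + 3%:R)%Z].
Proof.
move=> [c [c0 e N4 sq]] b3 pq qN.
have q2 : q != 2%N.
  apply: contra_eqN N4 => /eqP q2; move: qN; rewrite q2 => /dvdnP[k ->].
  by rewrite -[4%N]/(2 * 2)%N -muln_modl; lia.
have q3 : q != 3%N.
  apply/eqP => q3; have [r er] := norm_value_mod b.
  move: qN; rewrite q3 => qN.
  have h : (3 %| norm_value b)%Z by rewrite -e; exact: (dvdn_mulr _ qN).
  have : (3 %| (1 : int))%Z by have := rpredB h (dvdz_mulr r b3); rewrite er addrK.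
  by [].
have r3 : exists t : int, (q %| t ^+ 2 + 3%:R)%Z.
  (* From 4(A^2 - AB + B^2) = (2A - B)^2 + 3B^2, whence the factor 2 on c. *)
  apply: (residue_of_form pq qN (sq q pq) (c := (2 * c)%N) (x := 2%:R * normA b - normB b) (y := normB b)).
    by rewrite muln_gt0.
  transitivity (4%:R * norm_value b); first by rewrite -e expnMn; lia.
  by rewrite norm_value_Eisenstein; ring.
split=> //; first by case: r3 => t; apply: prime_dvd_sqrD3.
apply: (residue_of_form pq qN (sq q pq) (c := c) (x := nu0 b) (y := nu1 b)) => //.
Qed.

(** * No local points at a prime 3 mod 4 dividing N once *)

Lemma hensel_sqrt (q : nat) (d r0 : int) : prime q -> q != 2%N -> ~~ (q %| d)%Z ->
  (q %| r0 ^+ 2 + d)%Z -> forall m, exists r : int, ((q ^ m)%N %| r ^+ 2 + d)%Z.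
Proof.
move=> pq q2 qd h0 m; case: m => [|m]; first by exists 0; rewrite expn0 dvd1z.
elim: m => [|m [r /dvdzP[k rk]]]; first by exists r0; rewrite expn1.
have qr : ~~ (q %| r)%Z.
  apply: contra qd => qr; rewrite (_ : d = k * (q ^ m.+1)%N - r ^+ 2); last by rewrite -rk; ring.
  by rewrite expnS rpredB ?dvdz_mull ?dvdz_exp2l // ?expr2 ?dvdz_mull // PoszM dvdz_mulr.
have /coprimezP[[u v] /= uv] : coprimez (2%:R * r) q%:Z.
  rewrite coprimez_sym coprimezE absz_nat prime_coprime //; apply/negP => h.
  have : (q %| 2%:Z * r)%Z by exact: h.
  by rewrite dvdz_primeM // (negbTE qr) orbF dvdzE !absz_nat dvdn_prime2 // (negbTE q2).
exists (r - (q ^ m.+1)%N%:Z * k * u); apply/dvdzP.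
exists (k * v + (q ^ m)%N%:Z * k ^+ 2 * u ^+ 2).
transitivity ((r ^+ 2 + d) - 2%:R * r * u * (k * (q ^ m.+1)%N) + ((q ^ m.+1)%N%:Z * k * u) ^+ 2); first by ring.
rewrite rk (_ : 2%:R * r * u = 1 - v * q%:Z); last first.
  apply/eqP; rewrite -subr_eq0; apply/eqP.
  by transitivity (u * (2%:R * r) + v * q%:Z - 1); [ring | rewrite uv subrr].
by rewrite !expnS !PoszM; ring.
Qed.

Lemma dvdz_sum_sqr_3mod4 (q : nat) (x y : int) : prime q -> (q %% 4 = 3)%N ->
  (q %| x ^+ 2 + y ^+ 2)%Z -> (q %| x)%Z.
Proof.
move=> pq q4; rewrite -!Fp_intr_eq0 // => /eqP e.
pose X : 'F_q := x%:~R; pose Y : 'F_q := y%:~R.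
have e' : X ^+ 2 + Y ^+ 2 = 0 by rewrite -[RHS]e /X /Y; ring.
rewrite -/X; apply: contraT => X0.
have Y0 : Y != 0 by apply: contraNneq X0 => Y0; move: e'; rewrite Y0 expr0n addr0 => /eqP; rewrite sqrf_eq0.
pose i := X / Y.
have i2 : i ^+ 2 = -1.
  by rewrite /i expr_div_n; apply/eqP; rewrite -subr_eq0 opprK -(inj_eq (mulIf (expf_neq0 2 Y0))) mul0r mulrDl divfK ?expf_neq0 // mul1r e'.
have iq : i ^+ q = i by have := expf_card i; rewrite card_Fp.
have gen (F : fieldType) (j : F) l : j ^+ 2 = -1 -> j ^+ (l * 4 + 3) = - j.
  move=> h; rewrite exprD mulnC exprM -[4%N]/(2 * 2)%N exprM h sqrrN !expr1n mul1r.
  by rewrite exprS h mulrN1.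
have eq4 := divn_eq q 4; rewrite q4 in eq4.
have : i ^+ q = - i by have := gen _ i (q %/ 4)%N i2; rewrite -eq4.
have n2 : 2%:R != 0 :> 'F_q.
  have := Fp_intr_eq0 2 pq; rewrite -pmulrn => ->; rewrite dvdzE !absz_nat dvdn_prime2 //.
  by apply: contra_eqN q4 => /eqP ->.
rewrite iq => /eqP; rewrite -subr_eq0 opprK -mulr2n -mulr_natl mulf_eq0 (negbTE n2) /=.
by rewrite /i mulf_eq0 invr_eq0 (negbTE X0) (negbTE Y0).
Qed.

Lemma dvdz_congr (d x y : int) : (d %| x)%Z -> x = y -> (d %| y)%Z.
Proof. by move=> h <-. Qed.

(** Modulo q, x^2 + y^2 = 0 forces x = y = 0, then 2w^2 = 0 forces w = 0. After division by q the
    (z, v)-blocks give z^2 + 2v^2 = 0 and 2zv = 0, so z = v = 0. Stated modulo q^(2m), the absence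
    of Q_q-points applies to integer approximations, and no q-adic field is needed. *)
Lemma local_descent (q n : nat) : prime q -> (q %% 4 = 3)%N -> q != 3%N ->
  ~~ (q %| n)%N -> forall m b,
  ((q ^ (2 * m))%N %| pencil (q * n)%N%:R 1 0 b b)%Z ->
  ((q ^ (2 * m))%N %| pencil (q * n)%N%:R 0 1 b b)%Z ->
  forall k, (k < 5)%N -> ((q ^ m)%N %| b k)%Z.
Proof.
move=> pq q4 q3 qn; elim=> [|m IH] b; first by move=> *; rewrite expn0 dvd1z.
have q2 : q != 2%N by apply: contra_eqN q4 => /eqP ->.
have q0 : q%:Z != 0 by rewrite eqz_nat -lt0n prime_gt0.
have qp p : prime p -> q != p -> (q %| p%:Z)%Z = false.
  by move=> pp qp; rewrite dvdzE !absz_nat dvdn_prime2 // (negbTE qp).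
move=> h1 h2.
have Eq : (q ^ (2 * m.+1))%N = (q ^ (2 * m) * (q * q))%N by rewrite mulnS addnC expnD -mulnn.
case/dvdzP: h1 => k1 {}h1; case/dvdzP: h2 => k2 {}h2.
pose K1 := k1 * (q ^ (2 * m))%N%:Z; pose K2 := k2 * (q ^ (2 * m))%N%:Z.
have qnE : (q * n)%N%:R = q%:Z * n%:Z by rewrite natz PoszM.
rewrite qnE Eq !PoszM in h1 h2.
have {}h1 : pencil (q%:Z * n%:Z) 1 0 b b = K1 * q%:Z * q%:Z by rewrite h1 /K1; ring.
have {}h2 : pencil (q%:Z * n%:Z) 0 1 b b = K2 * q%:Z * q%:Z by rewrite h2 /K2; ring.
have [x xE] : exists x, b 0%N = x * q%:Z.
  apply/dvdzP; apply: (@dvdz_sum_sqr_3mod4 q _ (b 1%N)) => //; apply/dvdzP.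
  exists (K1 * q%:Z - 3%:R * n%:Z * (b 2%N * b 2%N + 2%:R * (b 3%N * b 3%N))).
  by rewrite mulrBl -h1 /pencil; ring.
have [y yE] : exists y, b 1%N = y * q%:Z.
  apply/dvdzP; apply: (@dvdz_sum_sqr_3mod4 q _ (b 0%N)) => //; apply/dvdzP.
  exists (K1 * q%:Z - 3%:R * n%:Z * (b 2%N * b 2%N + 2%:R * (b 3%N * b 3%N))).
  by rewrite mulrBl -h1 /pencil; ring.
have [w wE] : exists w, b 4%N = w * q%:Z.
  apply/dvdzP; have : (q %| 2%:Z * (b 4%N * b 4%N))%Z.
    apply/dvdzP; exists (K2 * q%:Z + x * b 0%N + (x * b 1%N + y * b 0%N)
      + 6%:R * n%:Z * (b 2%N * b 2%N + b 2%N * b 3%N + b 3%N * b 2%N + 2%:R * (b 3%N * b 3%N))).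
    by rewrite !mulrDl -h2 /pencil xE yE; ring.
  by rewrite !dvdz_primeM // qp //= orbb.
have d3 t : (q %| 3%:Z * n%:Z * t)%Z -> (q %| t)%Z.
  by rewrite !dvdz_primeM // qp //= [X in X || _]dvdzE !absz_nat (negbTE qn).
have zv1 : (q %| b 2%N * b 2%N + 2%:R * (b 3%N * b 3%N))%Z.
  apply: d3; apply/dvdzP; exists (K1 - x * x - y * y).
  by apply: (mulIf q0); rewrite !mulrBl -h1 /pencil xE yE; ring.
have zv2 : (q %| b 2%N * b 2%N + b 2%N * b 3%N + b 3%N * b 2%N + 2%:R * (b 3%N * b 3%N))%Z.
  have : (q %| 2%:Z * (b 2%N * b 2%N + b 2%N * b 3%N + b 3%N * b 2%N + 2%:R * (b 3%N * b 3%N)))%Z.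
    apply: d3; apply/dvdzP; exists (2%:R * w * w - x * x - 2%:R * x * y - K2).
    by apply: (mulIf q0); rewrite !mulrBl -h2 /pencil xE yE wE; ring.
  by rewrite dvdz_primeM // qp.
have zv : (q %| 2%:Z * (b 2%N * b 3%N))%Z.
  by apply: (dvdz_congr (rpredB zv2 zv1)); ring.
have [z zE [v vE _]] : exists2 z, b 2%N = z * q%:Z & exists2 v, b 3%N = v * q%:Z & True.
  have z2 : (q %| b 2%N)%Z -> (q %| b 3%N)%Z.
    move=> /dvdzP[z zE]; have : (q %| 2%:Z * (b 3%N * b 3%N))%Z.
      have : (q %| b 2%N * b 2%N)%Z by rewrite zE dvdz_mull ?dvdz_mull.
      by move/(rpredB zv1) => h; apply: (dvdz_congr h); ring.
    by rewrite !dvdz_primeM // qp //= orbb.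
  have v2 : (q %| b 3%N)%Z -> (q %| b 2%N)%Z.
    move=> /dvdzP[v vE]; have : (q %| b 2%N * b 2%N)%Z.
      have : (q %| 2%:R * (b 3%N * b 3%N))%Z by rewrite vE dvdz_mull ?dvdz_mull ?dvdz_mull.
      by move/(rpredB zv1) => h; apply: (dvdz_congr h); ring.
    by rewrite !dvdz_primeM // orbb.
  have [q2' q3'] : (q %| b 2%N)%Z /\ (q %| b 3%N)%Z.
    move: zv; rewrite !dvdz_primeM // qp //= => /orP[h | h]; split=> //; [exact: z2 | exact: v2].
  by case/dvdzP: q2' => z zE; case/dvdzP: q3' => v vE; exists z => //; exists v.
pose b' k := match k with 0 => x | 1%N => y | 2%N => z | 3%N => v | _ => w end.
have bE k : (k < 5)%N -> q%:Z * b' k = b k.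
  by case: k => [|[|[|[|[|]]]]] // _; rewrite mulrC /= ?xE ?yE ?zE ?vE ?wE.
have dv s u K : pencil (q%:Z * n%:Z) s u b b = K * q%:Z * q%:Z ->
    pencil (q * n)%N%:R s u b' b' = K.
  by move=> e; apply: (mulfI q0); apply: (mulfI q0); rewrite mulrA qnE (pencilZ _ _ _ bE bE) e; ring.
have {}IH := IH b'; rewrite (dv _ _ _ h1) (dv _ _ _ h2) /K1 /K2 !dvdz_mull // in IH.
move=> k lk; rewrite -bE // expnS PoszM; apply: dvdz_mul => //; exact: IH.
Qed.

Lemma dvdz_all_pow (q : nat) (z : int) : (1 < q)%N -> (forall m, ((q ^ m)%N %| z)%Z) -> z = 0.
Proof.
move=> q1 h; apply/eqP; rewrite -absz_eq0; apply: contraT; rewrite -lt0n => z0.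
have := h `|z|%N; rewrite dvdzE absz_nat => /(dvdn_leq z0).
by rewrite leqNgt ltn_expl.
Qed.

(** * Points over the biquadratic field Q(sqrt -2, sqrt -D) *)

Definition biquadratic (R : comPzRingType) (r t a b c e : R) : R := a + b * r + c * t + e * (r * t).

Section BiquadraticPencil.

Variables (R : comPzRingType) (N s u D : R) (a b c e : nat -> R).

Let p := pencil N s u.

(** The four quantities [biq1], [biqr], [biqt], [biqrt] are the components, in the basis 1, r, t, rt
    with r^2 = -2 and t^2 = -D, of the member at a + b r + c t + e rt. *)
Definition biq1 : R := p a a - 2%:R * p b b - D * p c c + 2%:R * D * p e e.
Definition biqr : R := 2%:R * p a b - 2%:R * D * p c e.
Definition biqt : R := 2%:R * p a c - 4%:R * p b e.
Definition biqrt : R := 2%:R * p a e + 2%:R * p b c.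

(** The error terms carry the factors r^2 + 2 and t^2 + D, so the identity serves both for exact
    roots in [algC] and for integers that are roots modulo a power of q. *)
Lemma pencil_biquadratic (r t : R) (y := fun k => biquadratic r t (a k) (b k) (c k) (e k)) :
  p y y = biquadratic r t biq1 biqr biqt biqrt
  + (r ^+ 2 + 2%:R) * (p b b + p e e * t ^+ 2 + 2%:R * p b e * t)
  + (t ^+ 2 + D) * (p c c - 2%:R * p e e + 2%:R * p c e * r).
Proof.
rewrite /biquadratic /biq1 /biqr /biqt /biqrt /y /biquadratic.
have sym x x' : p x x' = p x' x by rewrite /p /pencil; ring.
transitivity (p a a + p b b * r ^+ 2 + p c c * t ^+ 2 + p e e * (r * t) ^+ 2
  + 2%:R * (p a b * r + p a c * t + p a e * (r * t) + p b c * (r * t)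
            + p b e * (r ^+ 2 * t) + p c e * (r * t ^+ 2))).
  by rewrite /p /pencil; ring.
by ring.
Qed.

End BiquadraticPencil.

(** The four embeddings of the field in Q_q are replaced by the signs of integer approximations r, t
    modulo q^(2m). [local_descent] makes all four conjugates divisible by q^m; combining them
    isolates multiples of a, b, c, e that are divisible by every power of q, hence zero. *)
Lemma biquadratic_no_point (q n : nat) (D r0 t0 : int) (a b c e : nat -> int) :
  prime q -> (q %% 4 = 3)%N -> q != 3%N -> ~~ (q %| n)%N -> ~~ (q %| D)%Z ->
  (q %| r0 ^+ 2 + 2%:R)%Z -> (q %| t0 ^+ 2 + D)%Z ->
  (forall s u, [/\ biq1 (q * n)%N%:R s u D a b c e = 0, biqr (q * n)%N%:R s u D a b c e = 0,
     biqt (q * n)%N%:R s u a b c e = 0 & biqrt (q * n)%N%:R s u a b c e = 0]) ->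
  forall k, (k < 5)%N -> [/\ a k = 0, b k = 0, c k = 0 & e k = 0].
Proof.
move=> pq q4 q3 qn qD hr ht h k lk.
have q2 : q != 2%N by apply: contra_eqN q4 => /eqP ->.
have qp p : prime p -> q != p -> (q %| p%:Z)%Z = false.
  by move=> pp qp; rewrite dvdzE !absz_nat dvdn_prime2 // (negbTE qp).
have q2z : ~~ (q %| (2%:R : int))%Z by rewrite -[2%:R]/(2%:Z) qp.
have D0 : D != 0 by apply: contraNneq qD => ->; rewrite dvdz0.
have key m : exists r t : int, [/\ ((q ^ m)%N %| r ^+ 2 + 2%:R)%Z && ((q ^ m)%N %| t ^+ 2 + D)%Z,
    ((q ^ m)%N %| biquadratic r t (a k) (b k) (c k) (e k))%Z,
    ((q ^ m)%N %| biquadratic (- r) t (a k) (b k) (c k) (e k))%Z,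
    ((q ^ m)%N %| biquadratic r (- t) (a k) (b k) (c k) (e k))%Z
    & ((q ^ m)%N %| biquadratic (- r) (- t) (a k) (b k) (c k) (e k))%Z].
  have [r rm] := hensel_sqrt pq q2 q2z hr (2 * m).
  have [t tm] := hensel_sqrt pq q2 qD ht (2 * m).
  have le : ((q ^ m)%N%:Z %| (q ^ (2 * m))%N%:Z)%Z by rewrite dvdzE !absz_nat dvdn_exp2l // leq_pmull.
  exists r, t.
  have go r' t' : ((q ^ (2 * m))%N %| r' ^+ 2 + 2%:R)%Z -> ((q ^ (2 * m))%N %| t' ^+ 2 + D)%Z ->
      ((q ^ m)%N %| biquadratic r' t' (a k) (b k) (c k) (e k))%Z.
    move=> hr' ht'; apply: (@local_descent q n pq q4 q3 qn m
      (fun k => biquadratic r' t' (a k) (b k) (c k) (e k)) _ _ k lk).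
    - rewrite (pencil_biquadratic _ _ _ D); have [-> -> -> ->] := h 1 0.
      by rewrite /biquadratic !mul0r !add0r rpredD // dvdz_mulr.
    - rewrite (pencil_biquadratic _ _ _ D); have [-> -> -> ->] := h 0 1.
      by rewrite /biquadratic !mul0r !add0r rpredD // dvdz_mulr.
  by split; [rewrite (dvdz_trans le rm) (dvdz_trans le tm) | | | |] => //; apply: go; rewrite ?sqrrN.
have z0 (x : int) : (forall m, ((q ^ m)%N %| x)%Z) -> x = 0 := dvdz_all_pow (prime_gt1 pq).
have f0 (x y : int) : x != 0 -> x * y = 0 -> y = 0.
  by move=> x0 /eqP; rewrite mulf_eq0 (negbTE x0) => /eqP.
split.
- apply: (f0 4%:R) => //; apply: z0 => m; have [r [t [/andP[h1 h2] h3 h4 h5 h6]]] := key m.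
  by apply: (dvdz_congr (rpredD (rpredD h3 h4) (rpredD h5 h6))); rewrite /biquadratic; ring.
- apply: (f0 (- 8%:R)) => //; apply: z0 => m; have [r [t [/andP[h1 h2] h3 h4 h5 h6]]] := key m.
  by apply: (dvdz_congr (rpredB (dvdz_mulr r (rpredD (rpredB h3 h4) (rpredB h5 h6))) (dvdz_mulr (4%:R * b k) h1)));
    rewrite /biquadratic; ring.
- apply: (f0 (- 4%:R * D)); first by rewrite mulf_neq0.
  apply: z0 => m; have [r [t [/andP[h1 h2] h3 h4 h5 h6]]] := key m.
  by apply: (dvdz_congr (rpredB (dvdz_mulr t (rpredB (rpredD h3 h4) (rpredD h5 h6))) (dvdz_mulr (4%:R * c k) h2)));
    rewrite /biquadratic; ring.
apply: (f0 (8%:R * D)); first by rewrite mulf_neq0.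
apply: z0 => m; have [r [t [/andP[h1 h2] h3 h4 h5 h6]]] := key m.
by apply: (dvdz_congr (rpredD (rpredB (dvdz_mulr (r * t) (rpredB (rpredB h3 h4) (rpredB h5 h6)))
  (dvdz_mulr (4%:R * e k * t ^+ 2) h1)) (dvdz_mulr (8%:R * e k) h2)));
    rewrite /biquadratic; ring.
Qed.

(** The 2-adic valuations of the two sides have different parity. *)
Lemma sqr_eq_double_odd (D x y : int) : odd `|D| -> x ^+ 2 = 2%:R * D * y ^+ 2 -> x = 0 /\ y = 0.
Proof.
move=> oD e; have [y0 | y0] := eqVneq y 0.
  by split=> //; move/eqP: e; rewrite y0 expr0n mulr0 sqrf_eq0 => /eqP.
have D0 : (0 < `|D|)%N by case: `|D|%N oD.
have yy : (0 < `|y|)%N by rewrite absz_gt0.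
have en : (`|x| ^ 2 = 2 * `|D| * `|y| ^ 2)%N by rewrite -!abszX e !abszM.
have := congr1 (logn 2) en; rewrite lognX lognM ?muln_gt0 ?D0 ?expn_gt0 ?yy // lognX lognM //.
rewrite (_ : logn 2 `|D| = 0%N); last by rewrite lognE /= dvdn2 oD andbF.
by rewrite (pfactorK 1) //; lia.
Qed.

Section BiquadraticField.

Variables (D : int).
Hypotheses (D0 : 0 < D) (Dodd : odd `|D|).

Definition biq_r : algC := 'i * sqrtC 2%:R.
Definition biq_t : algC := 'i * sqrtC D%:~R.

Lemma biq_r2 : biq_r ^+ 2 = - 2%:R.
Proof. by rewrite /biq_r exprMn sqrCi sqrtCK mulN1r. Qed.

Lemma biq_t2 : biq_t ^+ 2 = - D%:~R.
Proof. by rewrite /biq_t exprMn sqrCi sqrtCK mulN1r. Qed.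

(** The generators are purely imaginary, so the real part relates 1 and rt, the imaginary part r and
    t; either relation would make 2D a rational square, impossible for D odd. *)
Lemma biquadratic_free (a b c e : int) :
  biquadratic biq_r biq_t a%:~R b%:~R c%:~R e%:~R = 0 -> [/\ a = 0, b = 0, c = 0 & e = 0].
Proof.
pose s2 : algC := sqrtC 2%:R; pose sD : algC := sqrtC D%:~R.
have s2r : s2 \is Num.real by rewrite ger0_real // sqrtC_ge0 ler0n.
have sDr : sD \is Num.real by rewrite ger0_real // sqrtC_ge0 ler0z ltW.
have s22 : s2 ^+ 2 = 2%:R by rewrite sqrtCK.
have sD2 : sD ^+ 2 = D%:~R by rewrite sqrtCK.
have zr (m : int) : m%:~R \is @Num.real algC by rewrite realz.
have -> : biquadratic biq_r biq_t a%:~R b%:~R c%:~R e%:~R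
    = (a%:~R - e%:~R * s2 * sD) + 'i * (b%:~R * s2 + c%:~R * sD).
  rewrite /biquadratic /biq_r /biq_t -/s2 -/sD.
  transitivity (a%:~R + 'i * (b%:~R * s2 + c%:~R * sD) + 'i ^+ 2 * (e%:~R * s2 * sD)); first by ring.
  by rewrite sqrCi; ring.
set x := a%:~R - _; set y := b%:~R * s2 + _ => z.
have xr : x \is Num.real by rewrite rpredB ?rpredM.
have yr : y \is Num.real by rewrite rpredD ?rpredM.
have x0 : x = 0 by rewrite -(Re_rect xr yr) z raddf0.
have y0 : y = 0 by rewrite -(Im_rect xr yr) z raddf0.
have [a0 e0] : a = 0 /\ e = 0.
  apply: (@sqr_eq_double_odd D) => //; apply: (@intr_inj algC).
  have ax : a%:~R = e%:~R * s2 * sD :> algC by apply/eqP; rewrite -subr_eq0 -/x x0.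
  transitivity ((a%:~R : algC) ^+ 2); first by ring.
  rewrite ax; transitivity ((e%:~R : algC) ^+ 2 * s2 ^+ 2 * sD ^+ 2); first by ring.
  by rewrite s22 sD2; ring.
have [c0 b0] : D * c = 0 /\ b = 0.
  apply: (@sqr_eq_double_odd D) => //; apply: (@intr_inj algC).
  have bx : c%:~R * sD = - (b%:~R * s2) :> algC by apply/eqP; rewrite -addr_eq0 addrC -/y y0.
  have bx' : c%:~R ^+ 2 * D%:~R = b%:~R ^+ 2 * 2%:R :> algC by rewrite -sD2 -s22 -!exprMn bx sqrrN.
  transitivity (D%:~R * (c%:~R ^+ 2 * D%:~R) : algC); first by ring.
  by rewrite bx'; ring.
split=> //; move/eqP: c0; rewrite mulf_eq0 gt_eqF //= => /eqP //.
Qed.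

Definition biq_mem (z : algC) : Prop := exists a b c e : rat,
  z = biquadratic biq_r biq_t (ratr a) (ratr b) (ratr c) (ratr e).

Lemma biq_mem_rat (a : rat) : biq_mem (ratr a).
Proof. by exists a, 0, 0, 0; rewrite /biquadratic !rmorph0; ring. Qed.

Lemma biq_memD x y : biq_mem x -> biq_mem y -> biq_mem (x + y).
Proof.
move=> [a [b [c [e ->]]]] [a' [b' [c' [e' ->]]]]; exists (a + a'), (b + b'), (c + c'), (e + e').
by rewrite /biquadratic !rmorphD /=; ring.
Qed.

Lemma biq_memM x y : biq_mem x -> biq_mem y -> biq_mem (x * y).
Proof.
move=> [a [b [c [e ->]]]] [a' [b' [c' [e' ->]]]]; pose d : rat := D%:~R.
exists (a * a' - 2%:R * b * b' - d * c * c' + 2%:R * d * e * e').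
exists (a * b' + b * a' - d * (c * e' + e * c')), (a * c' + c * a' - 2%:R * (b * e' + e * b')).
exists (a * e' + e * a' + b * c' + c * b').
have dE : ratr d = D%:~R :> algC by rewrite /d ratr_int.
rewrite !(rmorphD, rmorphN, rmorphM, rmorph_nat) /= dE /biquadratic.
move: biq_r2 biq_t2; move: biq_r biq_t => r t r2 t2.
move: (ratr a) (ratr b) (ratr c) (ratr e) (ratr a') (ratr b') (ratr c') (ratr e').
move=> {a b c e a' b' c' e'} a b c e a' b' c' e'.
apply/eqP; rewrite -subr_eq0; apply/eqP.
have r2' : r ^+ 2 + 2%:R = 0 by rewrite r2 addNr.
have t2' : t ^+ 2 + D%:~R = 0 by rewrite t2 addNr.
transitivity ((r ^+ 2 + 2%:R) * (b * b' + e * e' * t ^+ 2 + (b * e' + e * b') * t)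
  + (t ^+ 2 + D%:~R) * (c * c' - 2%:R * e * e' + (c * e' + e * c') * r)); first by ring.
by rewrite r2' t2' !mul0r addr0.
Qed.

Lemma biq_mem_mmap n (x : 'I_n -> algC) (p : {mpoly rat[n]}) :
  (forall i, biq_mem (x i)) -> biq_mem (mmap ratr x p).
Proof.
move=> hx; rewrite /mmap; apply: (big_ind biq_mem).
- by rewrite -(rmorph0 ratr); apply: biq_mem_rat.
- exact: biq_memD.
move=> m _; apply: biq_memM; first exact: biq_mem_rat.
rewrite /mmap1; apply: (big_ind biq_mem).
- by rewrite -(rmorph1 ratr); apply: biq_mem_rat.
- exact: biq_memM.
move=> i _; elim: (m i) => [|l IH]; first by rewrite expr0 -(rmorph1 ratr); apply: biq_mem_rat.
by rewrite exprS; apply: biq_memM.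
Qed.

(* Scaling to integral coordinates reduces a point over [Q(sqrt -2, sqrt -D)] to
   [biquadratic_no_point]. *)
Lemma no_point_over_biquadratic (q n : nat) (r0 t0 : int) (y : 'I_5 -> algC) :
  prime q -> (q %% 4 = 3)%N -> q != 3%N -> ~~ (q %| n)%N -> ~~ (q %| D)%Z ->
  (q %| r0 ^+ 2 + 2%:R)%Z -> (q %| t0 ^+ 2 + D)%Z ->
  (forall i, biq_mem (y i)) ->
  (forall s u, pencil (q * n)%N%:R s u (coordn y) (coordn y) = 0) -> forall i, y i = 0.
Proof.
move=> pq q4 q3 qn qD hr ht hy onY i.
have [f fE] : exists f : 'I_5 -> (rat * rat) * (rat * rat), forall i,
    y i = biquadratic biq_r biq_t (ratr (f i).1.1) (ratr (f i).1.2) (ratr (f i).2.1) (ratr (f i).2.2).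
  apply: (@fin_all_exists _ _ (fun i (g : (rat * rat) * (rat * rat)) =>
    y i = biquadratic biq_r biq_t (ratr g.1.1) (ratr g.1.2) (ratr g.2.1) (ratr g.2.2))) => j.
  by have [a [b [c [e ->]]]] := hy j; exists ((a, b), (c, e)).
have [da [a [da0 ha]]] := common_denominator 5 (coordn (fun i => (f i).1.1)).
have [db [b [db0 hb]]] := common_denominator 5 (coordn (fun i => (f i).1.2)).
have [dc [c [dc0 hc]]] := common_denominator 5 (coordn (fun i => (f i).2.1)).
have [de [e [de0 he]]] := common_denominator 5 (coordn (fun i => (f i).2.2)).
pose a' k := a k * (db * dc * de); pose b' k := b k * (da * dc * de).
pose c' k := c k * (da * db * de); pose e' k := e k * (da * db * dc).
pose d : algC := (da * db * dc * de)%:~R.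
have d0 : d != 0 by rewrite intr_eq0 !mulf_neq0.
pose Y k := biquadratic biq_r biq_t (a' k)%:~R (b' k)%:~R (c' k)%:~R (e' k)%:~R.
have rI (m l : int) (x : rat) : m%:~R = l%:~R * x -> m%:~R = l%:~R * ratr x :> algC.
  by move=> h; rewrite -[m%:~R](ratr_int algC) h rmorphM /= ratr_int.
have YE k : (k < 5)%N -> d * coordn y k = Y k.
  move=> lk; rewrite /Y /a' /b' /c' /e' !intrM (rI _ _ _ (ha k lk)) (rI _ _ _ (hb k lk)).
  rewrite (rI _ _ _ (hc k lk)) (rI _ _ _ (he k lk)) /coordn fE /d !intrM /biquadratic; ring.
have onYY s u : pencil (q * n)%N%:R s u Y Y = 0.
  by rewrite -(pencilZ _ _ _ YE YE) onY mulr0.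
have z k : (k < 5)%N -> [/\ a' k = 0, b' k = 0, c' k = 0 & e' k = 0].
  apply: (biquadratic_no_point pq q4 q3 qn qD hr ht) => s u.
  have := onYY s%:~R u%:~R; rewrite (pencil_biquadratic _ _ _ D%:~R) biq_r2 biq_t2 !addNr !mul0r !addr0.
  pose I : {rmorphism int -> algC} := intr.
  have nE : (q * n)%N%:R = I (q * n)%N%:R by rewrite rmorph_nat.
  have pE x x' : pencil (q * n)%N%:R s%:~R u%:~R (fun k => (x k)%:~R) (fun k => (x' k)%:~R)
      = (pencil (q * n)%N%:R s u x x')%:~R :> algC.
    by rewrite -[RHS]/(I _) (rmorph_pencil I) nE.
  rewrite /biq1 /biqr /biqt /biqrt !pE => h.
  by apply: biquadratic_free; rewrite -[RHS]h; congr (biquadratic _ _ _ _ _ _); ring.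
have Yi : Y i = 0.
  by have [ya yb yc ye] := z i (ltn_ord i); rewrite /Y ya yb yc ye /biquadratic; ring.
move/eqP: Yi; rewrite -YE // mulf_eq0 (negbTE d0) /= /coordn inord_val => /eqP //.
Qed.

End BiquadraticField.

(** * Excluding morphisms between two surfaces *)

(** Near one chosen point a morphism is given by forms with rational coefficients, which preserve
    the biquadratic field; the image is on the target only up to the scalar [l] from [algC],
    harmless for homogeneous equations. *)
Lemma no_surface_morphism (M q n : nat) (r0 t0 : int)
    (f : 'rV[algC]_5 -> 'rV[algC]_5) :
  (0 < M)%N -> odd M -> prime q -> (q %% 4 = 3)%N -> q != 3%N -> ~~ (q %| n)%N -> ~~ (q %| M)%N ->
  (q %| r0 ^+ 2 + 2%:R)%Z -> (q %| t0 ^+ 2 + (3 * M)%N%:Z)%Z ->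
  is_morphism (X := surface M) (Y := surface (q * n)) f -> False.
Proof.
move=> M0 Modd pq q4 q3 qn qM hr ht mf.
pose D : int := (3 * M)%N%:Z.
have D0 : 0 < D by rewrite /D ltz_nat muln_gt0.
have Dodd : odd `|D| by rewrite /D absz_nat oddM Modd.
have qD : ~~ (q %| D)%Z.
  by rewrite /D dvdzE !absz_nat Euclid_dvdM // negb_or qM dvdn_prime2 // q3.
have DE : D%:~R = 3%:R * M%:R :> algC by rewrite /D -natrM.
pose t := biq_t D; pose r := biq_r.
have t2 : t ^+ 2 = - (3%:R * M%:R) by rewrite biq_t2 DE.
have r2 : r ^+ 2 = - 2%:R by exact: biq_r2.
(* The quartic point again: w = rt/2 satisfies 2w^2 = (-2)(-3M)/2 = 3M. *)
pose px := tuple5 t 0 1 0 (r * t / 2%:R).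
pose x : 'rV[algC]_5 := \row_i px i.
have w2 : 2%:R * (r * t / 2%:R * (r * t / 2%:R)) = 3%:R * M%:R.
  transitivity (r ^+ 2 * t ^+ 2 / 2%:R); first by field.
  by rewrite r2 t2; field.
have x_on : on_forms ratr (X := surface M) (x 0).
  have : on_forms ratr (X := surface M) (fun i : 'I_5 => px i).
    apply: on_surface_of_pencil; rewrite /pencil /px /=.
      rewrite (_ : _ + _ = t ^+ 2 + 3%:R * M%:R); last by ring.
      by rewrite t2 addNr.
    rewrite w2 (_ : _ + _ = 3%:R * M%:R - t ^+ 2 - 6%:R * M%:R); last by ring.
    by rewrite t2; ring.
  case; rewrite /= (mmap_quad1 ratr) (mmap_quad2 ratr) => e1 e2; split.
    by rewrite /= (mmap_quad1 ratr) !mxE; exact: e1.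
  by rewrite /= (mmap_quad2 ratr) !mxE; exact: e2.
have x_geom : geom_point (X := surface M) x.
  split=> //; apply/eqP => x0; have := congr1 (fun z : 'rV[algC]_5 => z 0 i2) x0.
  by rewrite !mxE /px /= => /eqP; rewrite oner_eq0.
have [[fx0 fx_on] [d [F [_ Fx0 hF]]]] := mf x x_geom.
have [l l0 fE] := hF x x_geom Fx0.
set Fx := (X in X != 0) in Fx0; rewrite -/Fx in fE.
have mem i : biq_mem D (Fx 0 i).
  rewrite mxE; apply: biq_mem_mmap => j; rewrite mxE /px.
  have m0 (a : rat) := biq_mem_rat D a.
  have mt : biq_mem D t.
    by exists 0, 0, 1, 0; rewrite /biquadratic !rmorph0 rmorph1 !(mul0r, mul1r, add0r, addr0).
  have mr : biq_mem D r.
    by exists 0, 1, 0, 0; rewrite /biquadratic !rmorph0 rmorph1 !(mul0r, mul1r, add0r, addr0).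
  have mw : biq_mem D (r * t / 2%:R).
    have -> : 2%:R^-1 = ratr (2%:R^-1) :> algC by rewrite fmorphV rmorph_nat.
    by apply: biq_memM => //; apply: biq_memM.
  have m00 : biq_mem D 0 by have := m0 0; rewrite rmorph0.
  have m01 : biq_mem D 1 by have := m0 1; rewrite rmorph1.
  by case: j => [[|[|[|[|[|]]]]] lj].
have onF s u : pencil (q * n)%N%:R s u (coordn (Fx 0)) (coordn (Fx 0)) = 0.
  have h := on_surface_pencil (f := ratr) fx_on s u.
  have e k : (k < 5)%N -> l * coordn (Fx 0) k = coordn (f x 0) k.
    by move=> _; rewrite fE /coordn [RHS]mxE.
  move/eqP: h; rewrite -(pencilZ _ _ _ e e) mulf_eq0 mulf_eq0 (negbTE l0) => /eqP //.
have z := no_point_over_biquadratic D0 Dodd pq q4 q3 qn qD hr ht mem onF.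
by case/eqP: Fx0; apply/rowP => i; rewrite z mxE.
Qed.

(** * The index *)

Lemma surface_point_sextic (N c : nat) (b : int) : (0 < N)%N -> (0 < c)%N ->
  (N * c ^ 2)%N%:Z = norm_value b ->
  exists P : closed_point (surface N), (cp_degree P %| 6)%N.
Proof.
move=> N0 c0 e.
have [k0 rk] : exists k0 : algC, root ('X^3 + ('X + 1%:P)) k0.
  by apply/closed_rootP; rewrite size_polyDl size_polyXn ?size_XaddC.
have ek0 : k0 ^+ 3 + k0 + 1 = 0 by move/rootP: rk; rewrite !hornerE ?addrA.
pose th0 := sqrtC (plane_disc N%:R c%:R (normU b%:~R k0) (normV b%:~R k0) k0).
have [L [f [s sE gen]]] := num_field_exists [:: k0; th0].
case: s sE gen => [|k [|th [|]]] //= [ek eth] gen.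
have kk : k ^+ 3 + k + 1 = 0.
  by apply: (fmorph_inj f); rewrite !(rmorphD f) (rmorphXn f) rmorph1 rmorph0 ek ek0.
have tt : th ^+ 2 = plane_disc N%:R c%:R (normU b%:~R k) (normV b%:~R k) k.
  apply: (fmorph_inj f); rewrite (rmorphXn f) eth sqrtCK (rmorph_plane_disc f).
  by rewrite (rmorph_normU f) (rmorph_normV f) ek (rmorph_int f) !(rmorph_nat f).
have nz m : (0 < m)%N -> m%:R != 0 :> L.
  by move=> m0; rewrite -(rmorph_nat (in_alg L)) fmorph_eq0 pnatr_eq0 -lt0n.
have nv : norm_value (b%:~R : L) = (norm_value b)%:~R.
  by symmetry; apply: (rmorph_norm_value (intr : {rmorphism int -> L})).
have hn : N%:R * c%:R ^+ 2 = normU b%:~R k ^+ 2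
    + 2%:R * (k ^+ 2 - 2%:R * k - 1) * normV b%:~R k ^+ 2.
  by rewrite -(norm_valueE _ kk) nv -e -pmulrn natrM natrX.
have [p [p1 p2 p3]] := plane_point (nz 3%N isT) (nz N N0) (nz c c0) kk hn tt.
have on := on_surface_of_pencil (in_alg L) p1 p2.
have [|P hP] := closed_point_of_field on.
  by case/orP: p3 => h; [exists i0 | exists i4].
exists P; apply: dvdn_trans hP _; rewrite -gen adjoin_cons adjoin_seq1.
have th2 : th ^+ 2 \in <<1; k>>%VS.
  apply/Fadjoin1_polyP.
  (* The discriminant formula at the variable X is a rational polynomial with value th^2 at k, so
     th^2 lies in Q(k). *)
  exists (plane_disc N%:R c%:R (normU b%:~R 'X) (normV b%:~R 'X) 'X).
  pose h : {rmorphism {poly rat} -> L} := horner_alg k.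
  have hX : h 'X = k by exact: horner_algX.
  rewrite tt -[RHS]/(h _) (rmorph_plane_disc h) (rmorph_normU h) (rmorph_normV h).
  by rewrite (rmorph_int h) !(rmorph_nat h) hX.
apply: dvdn_trans (@dim_adjoin_sqrt L <<1; k>>%AS th th2) _.
by rewrite -[6%N]/(2 * 3)%N dvdn_pmul2l // dim_adjoin_cubic.
Qed.

Lemma surface_index (N c : nat) (b : int) : (0 < N)%N -> (0 < c)%N ->
  (N * c ^ 2)%N%:Z = norm_value b -> has_index (surface N) 2.
Proof.
move=> N0 c0 e; split=> [P | d hd]; first exact: surface_even_degree.
have [P hP] := surface_point_quartic N; have [P' hP'] := surface_point_sextic N0 c0 e.
have : (d %| gcdn 4 6)%N by rewrite dvdn_gcd (dvdn_trans (hd P) hP) (dvdn_trans (hd P') hP').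
by [].
Qed.

(** * The sequence of levels *)

(** The base b = (3m)^2 is divisible by 3 and by m, and it is 1 mod 8 for odd m. [epsilon] makes the
    choice of N total in m; its specification is available for odd m. *)
Definition next_level (m : nat) : nat :=
  epsilon (inhabits 0%N) (norm_squarefree ((3 * m)%N%:Z ^+ 2)).

(** The product of all earlier levels, so that every prime of an earlier level divides the base of
    the next one. *)
Fixpoint level_prod (i : nat) : nat :=
  if i is j.+1 then (level_prod j * next_level (level_prod j))%N else 1%N.

Definition level (i : nat) : nat := next_level (level_prod i).

Lemma next_levelP m : odd m -> norm_squarefree ((3 * m)%N%:Z ^+ 2) (next_level m).
Proof.
move=> om; apply: epsilon_spec.
have on : odd (3 * m) by rewrite oddM om.
have e : ((3 * m) ^ 2 %% 8 = 1)%N.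
  rewrite -modnXm; have : odd ((3 * m) %% 8) by rewrite odd_mod.
  have := ltn_pmod (3 * m) (isT : 0 < 8)%N.
  by move: ((3 * m) %% 8)%N => [|[|[|[|[|[|[|[|?]]]]]]]].
have -> : (3 * m)%N%:Z ^+ 2 = 8%:R * ((3 * m) ^ 2 %/ 8)%N%:Z + 1.
  have := divn_eq ((3 * m) ^ 2) 8; rewrite e => e'.
  transitivity (((3 * m) ^ 2)%N%:Z); first by rewrite -mulnn PoszM expr2.
  by rewrite {1}e' PoszD PoszM mulrC.
exact: norm_squarefree_exists.
Qed.

Lemma norm_squarefree_odd b N : norm_squarefree b N -> odd N /\ (0 < N)%N.
Proof.
move=> [c [_ _ N4 _]]; have oN : odd N by rewrite -(@odd_mod N 4) // N4.
by split=> //; case: N oN {N4}.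
Qed.

Lemma level_prod_odd i : odd (level_prod i).
Proof.
elim: i => //= i IH; rewrite oddM IH.
by have [] := norm_squarefree_odd (next_levelP IH).
Qed.

Lemma levelP i : norm_squarefree ((3 * level_prod i)%N%:Z ^+ 2) (level i).
Proof. exact: next_levelP (level_prod_odd i). Qed.

Lemma level_dvd j i : (j < i)%N -> (level j %| level_prod i)%N.
Proof.
elim: i => // i IH; rewrite ltnS leq_eqVlt /= => /orP[/eqP -> | ji].
  exact: dvdn_mull.
by apply: dvdn_mulr; apply: IH.
Qed.

Lemma level_base_dvd3 i : (3 %| (3 * level_prod i)%N%:Z ^+ 2)%Z.
Proof. by rewrite PoszM expr2 -!mulrA dvdz_mulr. Qed.

(** Only morphisms from a later surface to an earlier one are excluded, since the base of the later
    level is divisible by q; an isomorphism provides one in each direction. *)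
Lemma no_level_morphism j i (f : 'rV[algC]_5 -> 'rV[algC]_5) : (j < i)%N ->
  is_morphism (X := surface (level i)) (Y := surface (level j)) f -> False.
Proof.
move=> ji mf.
have Nj := levelP j; have Mi := levelP i.
have [oM M0] := norm_squarefree_odd Mi.
have N4 : (level j %% 4 = 3)%N by case: Nj => ? [].
have [q [pq qN q4]] := prime_3mod4 N4.
have [q2 q3 _ [r0 hr] [s0 hs]] := norm_squarefree_prime Nj (level_base_dvd3 j) pq qN.
case/dvdnP: (qN) => n; rewrite mulnC => nE.
have qn : ~~ (q %| n)%N.
  have [? [_ _ _ sq]] := Nj; apply: contra (sq q pq) => /dvdnP[n' n'E].
  by rewrite nE n'E mulnCA -mulnn dvdn_mull.
have [c [c0 eM _ _]] := Mi.
set M := level i in oM M0 eM mf Mi; set bi := (3 * level_prod i)%N%:Z ^+ 2 in eM Mi.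
have qb : (q %| bi)%Z.
  rewrite /bi expr2 dvdz_mulr // PoszM dvdz_mull //.
  exact: dvdn_trans qN (level_dvd ji).
have [r er] := norm_value_mod (bi : int).
have Mc : M%:Z * c%:Z ^+ 2 = 1 + bi * r by rewrite -er -eM PoszM -mulnn PoszM expr2.
have qM : ~~ (q %| M)%N.
  apply/negP => qM; have h : (q %| M%:Z * c%:Z ^+ 2)%Z by apply: dvdz_mulr; exact: qM.
  have : (q %| (1 : int))%Z by have := rpredB h (dvdz_mulr r qb); rewrite Mc addrK.
  by rewrite dvdzE absz_nat dvdn1 => /eqP q1; move: pq; rewrite q1.
(* Since M c^2 = 1 mod q, M c is a square root of M modulo q; multiplied by the root s0 of -3 it
   gives one of -3M. *)
have ht : (q %| (s0 * (M%:Z * c%:Z)) ^+ 2 + (3 * M)%N%:Z)%Z.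
  have -> : (s0 * (M%:Z * c%:Z)) ^+ 2 + (3 * M)%N%:Z
      = (s0 ^+ 2 + 3%:R) * (M%:Z ^+ 2 * c%:Z ^+ 2) - 3%:R * M%:Z * (M%:Z * c%:Z ^+ 2 - 1).
    by rewrite PoszM; ring.
  rewrite Mc; apply: rpredB; first exact: dvdz_mulr.
  have -> : 1 + bi * r - 1 = bi * r by rewrite addrC addKr.
  by apply: dvdz_mull; apply: dvdz_mulr.
rewrite nE in mf.
exact: (no_surface_morphism M0 oM pq q4 q3 qn qM hr ht mf).
Qed.

Theorem theorem0p1 :
  exists X : nat -> quadric_pair,
    (forall i : nat,
       [/\ smooth_intersection_of_two_quadrics (X i),
           has_index (X i) 2
         & ~ exists P : closed_point (X i), cp_degree P = 2%N])
    /\ (forall i j : nat, i <> j -> ~ isomorphic (X i) (X j)).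
Proof.
exists (fun i => surface (level i)); split=> [i | i j ij [f [g [mf mg _ _]]]].
  have Ni := levelP i; have [_ N0] := norm_squarefree_odd Ni.
  split; first exact: surface_smooth_intersection.
    by have [c [c0 e _ _]] := Ni; apply: surface_index e.
  apply: surface_no_degree2 => // p pp pN.
  by have [] := norm_squarefree_prime Ni (level_base_dvd3 i) pp pN.
have [lt | lt | //] := ltngtP i j; [exact: no_level_morphism lt mg | exact: no_level_morphism lt mf].
Qed.
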